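(* Let $r\ge 1$ be an integer, $\mathbf n=(n_1,\dots,n_r)\in\mathbb N_0^r$, $\mathbf a=(a_1,\dots,a_{r+1})$ with all $a_j>0$, and $\alpha=(\alpha_1,\dots,\alpha_{r+1})$ with all $\alpha_j>-1$ (real parameters). Then for all $(\xi_1,\dots,\xi_r)\in\mathbb R^r$, $$\mathcal F\big(g_r(\,\cdot\,;\mathbf n,\mathbf a,\alpha)\big)(\xi_1,\dots,\xi_r)=2^{\,r(a_r+a_{r+1}-1)+\sum_{j=1}^{r-1}j a_j}\prod_{j=1}^r\left\{\frac{\big(2|\mathbf n^{j+1}|+|\alpha^{j+1}|+r-j+1\big)_{n_j}}{n_j!}\,\Lambda_j^r(\mathbf a,\alpha,\mathbf n;\xi_j)\right\},$$ where $$\Lambda_j^r(\mathbf a,\alpha,\mathbf n;\xi_j)=B\Big(a_j-\tfrac{i\xi_j}{2},\,|\mathbf n^{j+1}|+|\mathbf a^{j+1}|+\tfrac{i\xi_j}{2}\Big)\;{}_3F_2\left(\begin{matrix}-n_j,\; n_j+2|\mathbf n^{j+1}|+|\alpha^{j}|+r-j+1,\; |\mathbf n^{j+1}|+|\mathbf a^{j+1}|+\frac{i\xi_j}{2}\\ 2|\mathbf n^{j+1}|+|\alpha^{j+1}|+r-j+1,\; |\mathbf n^{j+1}|+|\mathbf a^{j}|\end{matrix}\,\Big|\,1\right),$$ or, equivalently, in terms of the continuous Hahn polynomials, $$\Lambda_j^r(\mathbf a,\alpha,\mathbf n;\xi_j)=\frac{n_j!\,B\big(a_j-\frac{i\xi_j}{2},\,|\mathbf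 n^{j+1}|+|\mathbf a^{j+1}|+\frac{i\xi_j}{2}\big)}{i^{n_j}\big(|\mathbf n^{j+1}|+|\mathbf a^{j}|\big)_{n_j}\big(2|\mathbf n^{j+1}|+|\alpha^{j+1}|+r-j+1\big)_{n_j}}\;p_{n_j}\Big(\tfrac{\xi_j}{2};\,|\mathbf n^{j+1}|+|\mathbf a^{j+1}|,\;\alpha_j-a_j+1,\;|\mathbf n^{j+1}|+|\alpha^{j+1}|-|\mathbf a^{j+1}|+r-j+1,\;a_j\Big).$$
   Context: Notation: $\mathbb N_0=\{0,1,2,\dots\}$; $(c)_k=c(c+1)\cdots(c+k-1)$, $(c)_0=1$; $B(u,v)=\int_0^1 t^{u-1}(1-t)^{v-1}dt=\Gamma(u)\Gamma(v)/\Gamma(u+v)$ for $\Re u,\Re v>0$; ${}_3F_2\left(\begin{matrix}c_1,c_2,c_3\\ d_1,d_2\end{matrix}\Big|z\right)=\sum_{k\ge0}\frac{(c_1)_k(c_2)_k(c_3)_k}{(d_1)_k(d_2)_k}\frac{z^k}{k!}$ (a finite sum when $c_1=-n$, $n\in\mathbb N_0$). For tuples write $|\mathbf n^j|=n_j+\cdots+n_r$ with $|\mathbf n^{r+1}|=0$, $|\mathbf a^j|=a_j+\cdots+a_{r+1}$, $|\alpha^j|=\alpha_j+\cdots+\alpha_{r+1}$. Jacobi polynomials: $P_n^{(\alpha,\beta)}(x)=2^{-n}\sum_{k=0}^n\binom{n+\alpha}{k}\binom{n+\beta}{n-k}(x+1)^k(x-1)^{n-k}$. Orthogonal polynomials on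 the simplex: for $\boldsymbol x=(x_1,\dots,x_r)$ and $|\boldsymbol x_{j}|=x_1+\cdots+x_j$, $|\boldsymbol x_0|=0$, $$P_{\mathbf n}^{(\alpha)}(\boldsymbol x)=\prod_{j=1}^r(1-|\boldsymbol x_{j-1}|)^{n_j}P_{n_j}^{(A_j,\alpha_j)}\Big(\frac{2x_j}{1-|\boldsymbol x_{j-1}|}-1\Big),\qquad A_j=2|\mathbf n^{j+1}|+|\alpha^{j+1}|+r-j.$$ The function $g_r$: for $\boldsymbol x\in\mathbb R^r$, $$g_r(\boldsymbol x;\mathbf n,\mathbf a,\alpha)=\prod_{j=1}^r(1+\tanh x_j)^{a_j}(1-\tanh x_j)^{|\mathbf a^{j+1}|}\;P_{\mathbf n}^{(\alpha)}(\Upsilon_1,\dots,\Upsilon_r),$$ where $\Upsilon_1=\frac{1+\tanh x_1}{2}$ and $\Upsilon_k=2^{-k}(1-\tanh x_1)\cdots(1-\tanh x_{k-1})(1+\tanh x_k)$ for $2\le k\le r$. Fourier transform: $\mathcal F(g)(\xi_1,\dots,\xi_r)=\int_{\mathbb R^r}e^{-i(\xi_1x_1+\cdots+\xi_rx_r)}g(x_1,\dots,x_r)\,dx_1\cdots dx_r$. Continuous Hahn polynomials: $p_n(x;a,b,c,d)=i^n\frac{(a+c)_n(a+d)_n}{n!}\;{}_3F_2\left(\begin{matrix}-n,\;n+a+b+c+d-1,\;a+ix\\ a+c,\;a+d\end{matrix}\Big|1\right)$. *)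

(* Defs.v *)
From HB Require Import structures.
From mathcomp Require Import all_boot all_order all_algebra.
From mathcomp Require Import all_classical all_reals all_analysis.
From mathcomp Require Import complex.

Set Implicit Arguments.
Unset Strict Implicit.
Unset Printing Implicit Defensive.

Import Order.TTheory GRing.Theory Num.Theory.
Import numFieldNormedType.Exports.

Local Open Scope classical_set_scope.
Local Open Scope ring_scope.
Local Open Scope complex_scope.

(* The library has no Lebesgue measure on R^n.  It is built here as the n-fold
   product of the one-dimensional one, on the product sigma-algebra that the
   library puts on [n.-tuple T]. *)
Section cons_measure.
Context d (T : measurableType d) (R : realType) (n : nat).

Definition cons_pair (p : T * n.-tuple T) : n.+1.-tuple T :=
  [tuple of p.1 :: p.2].

Lemma measurable_cons_pair : measurable_fun setT cons_pair.
Proof. exact: measurable_cons. Qed.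

Definition cons_measure (m1 : set T -> \bar R) (m2 : set (n.-tuple T) -> \bar R) :=
  pushforward (m1 \x m2)%E cons_pair.

Variables (m1 : {sigma_finite_measure set T -> \bar R})
  (m2 : {sigma_finite_measure set (n.-tuple T) -> \bar R}).

Let mu : set (n.+1.-tuple T) -> \bar R := cons_measure m1 m2.

Let mu0 : mu set0 = 0%E.
Proof. by rewrite /mu /cons_measure /pushforward preimage_set0 measure0. Qed.

Let mu_ge0 A : (0 <= mu A)%E.
Proof. by apply: integral_ge0 => x _; exact: measure_ge0. Qed.

Let mu_sigma_additive : semi_sigma_additive mu.
Proof.
move=> F mF tF mUF; rewrite /mu /cons_measure /pushforward preimage_bigcup.
apply: measure_semi_sigma_additive.
- by move=> k; rewrite -[X in measurable X]setTI; exact: measurable_cons_pair.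
- apply/trivIsetP => /= i j _ _ ij; rewrite -preimage_setI.
  by move/trivIsetP : tF => /(_ _ _ _ _ ij) ->//; rewrite preimage_set0.
- by rewrite -preimage_bigcup -[X in measurable X]setTI;
    exact: measurable_cons_pair.
Qed.

HB.instance Definition _ := isMeasure.Build _ _ _ (cons_measure m1 m2)
  mu0 mu_ge0 mu_sigma_additive.

Let mu_sigma_finite : sigma_finite setT mu.
Proof.
have /sigma_finiteP[F [TF ndF Foo]] := sigma_finiteT m1.
have /sigma_finiteP[G [TG ndG Goo]] := sigma_finiteT m2.
pose tl (t : n.+1.-tuple T) : n.-tuple T := [tuple of behead t].
pose H k := (fun t : n.+1.-tuple T => tnth t ord0) @^-1` F k `&` tl @^-1` G k.
exists H => [|k].
- apply/esym; rewrite -subTset => t _.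
  have /= [i _ Fi] : (\bigcup_i F i) (tnth t ord0) by rewrite -TF.
  have /= [j _ Gj] : (\bigcup_i G i) (tl t) by rewrite -TG.
  exists (maxn i j) => //; split.
  + by have /subsetPset := ndF _ _ (leq_maxl i j); exact.
  + by have /subsetPset := ndG _ _ (leq_maxr i j); exact.
- have [mF Fk] := Foo k; have [mG Gk] := Goo k; split.
  + apply: measurableI; rewrite -[X in measurable X]setTI.
      exact: measurable_tnth.
    exact: measurable_behead.
  + rewrite /mu /cons_measure /pushforward.
    have -> : cons_pair @^-1` H k = F k `*` G k.
      rewrite /H /cons_pair; apply/seteqP; split => -[x t] /=;
      rewrite (_ : tl _ = t) //; exact/val_inj.
    by rewrite product_measure1E// lte_mul_pinfty// ge0_fin_numE.
Qed.

HB.instance Definition _ := Measure_isSigmaFinite.Build _ _ _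
  (cons_measure m1 m2) mu_sigma_finite.

End cons_measure.

Section lebesgue_tuple.
Context {R : realType}.
Local Notation RT := (measurableTypeR R).

Fixpoint lebesgue_tuple n :
    {sigma_finite_measure set (n.-tuple RT) -> \bar R} :=
  match n with
  | 0 => [the {sigma_finite_measure set (0.-tuple RT) -> \bar R} of
           \d_([tuple] : 0.-tuple RT)]
  | m.+1 => [the {sigma_finite_measure set (m.+1.-tuple RT) -> \bar R} of
           cons_measure lebesgue_measure (lebesgue_tuple m)]
  end.
End lebesgue_tuple.

(* Indices run from 1, as in the formulas below: [ith s j] is the j-th entry of
   [s], counted from 1. *)
Section tuple_sums.
Context {V : nmodType}.
Implicit Types (s : seq V) (j : nat).

Definition ith s j : V := s`_j.-1.

(* |s^j| = s_j + s_{j+1} + ...; it is 0 for j > size s *)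
Definition tail_sum s j : V := \sum_(j <= i < (size s).+1) ith s i.

(* |s_j| = s_1 + ... + s_j *)
Definition head_sum s j : V := \sum_(1 <= i < j.+1) ith s i.

End tuple_sums.

Definition pochhammer (K : pzSemiRingType) (c : K) (k : nat) : K :=
  \prod_(i < k) (c + i%:R).

Section real_functions.
Context {R : realType}.
Implicit Types x : R.

Definition tanh x : R := (expR x - expR (- x)) / (expR x + expR (- x)).

(* binomial coefficient with a real upper argument *)
Definition gbinom (c : R) (k : nat) : R := (\prod_(i < k) (c - i%:R)) / k`!%:R.

Definition jacobi (n : nat) (alpha beta x : R) : R :=
  2 ^- n * \sum_(k < n.+1) gbinom (n%:R + alpha) k * gbinom (n%:R + beta) (n - k)
                           * (x + 1) ^+ k * (x - 1) ^+ (n - k).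

End real_functions.

Section complex_functions.
Context {R : realType}.
Implicit Types z : R[i].

Definition cexp z : R[i] := (expR (complex.Re z))%:C * (cos (complex.Im z) +i* sin (complex.Im z)).

(* principal power, for a base t > 0 *)
Definition cpower (t : R) z : R[i] := cexp (z * (ln t)%:C).

Definition cintegral d (T : measurableType d) (mu : {measure set T -> \bar R})
    (D : set T) (f : T -> R[i]) : R[i] :=
  (\int[mu]_(x in D) complex.Re (f x)) +i* (\int[mu]_(x in D) complex.Im (f x)).

Definition cbeta (u v : R[i]) : R[i] :=
  cintegral lebesgue_measure `]0, 1[
    (fun t : R => cpower t (u - 1) * cpower (1 - t) (v - 1)).

(* The type annotation only selects the topology of the numFieldType R[i]. *)
Definition hyp3F2 (c1 c2 c3 d1 d2 z : R[i]) : R[i] :=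
  limn (fun m => \sum_(k < m)
    (pochhammer c1 k * pochhammer c2 k * pochhammer c3 k)
    / (pochhammer d1 k * pochhammer d2 k) * (z ^+ k / k`!%:R)
    : (R[i] : numFieldType)).

Definition continuous_hahn (n : nat) (x a b c d : R[i]) : R[i] :=
  'i%C ^+ n * (pochhammer (a + c) n * pochhammer (a + d) n / n`!%:R)
  * hyp3F2 (- n%:R) (n%:R + a + b + c + d - 1) (a + 'i%C * x) (a + c) (a + d) 1.

Definition fourier r (g : r.-tuple R -> R[i]) (xi : r.-tuple R) : R[i] :=
  cintegral (lebesgue_tuple r) setT
    (fun x => cexp (- ('i%C * (\sum_(1 <= j < r.+1) ith xi j * ith x j)%:C)) * g x).

End complex_functions.

Section simplex.
Context {R : realType} (r : nat).
Implicit Types (n : r.-tuple nat) (a alpha : r.+1.-tuple R) (x : r.-tuple R).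

Definition simplex_A n alpha (j : nat) : R :=
  2 * (tail_sum n j.+1)%:R + tail_sum alpha j.+1 + r%:R - j%:R.

Definition simplex_poly n alpha x : R :=
  \prod_(1 <= j < r.+1)
    ((1 - head_sum x j.-1) ^+ ith n j
     * jacobi (ith n j) (simplex_A n alpha j) (ith alpha j)
         (2 * ith x j / (1 - head_sum x j.-1) - 1)).

Definition Upsilon x (k : nat) : R :=
  2 ^- k * (\prod_(1 <= i < k) (1 - tanh (ith x i))) * (1 + tanh (ith x k)).

Definition Upsilon_tuple x : r.-tuple R := [tuple Upsilon x k.+1 | k < r].

Definition g_fun n a alpha x : R :=
  (\prod_(1 <= j < r.+1) ((1 + tanh (ith x j)) `^ ith a j
                         * (1 - tanh (ith x j)) `^ tail_sum a j.+1))
  * simplex_poly n alpha (Upsilon_tuple x).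

Definition Lambda a alpha n (j : nat) (xi : R) : R[i] :=
  let nj := ith n j in
  let N : R := (tail_sum n j.+1)%:R in
  let s : R[i] := 'i%C * xi%:C / 2 in
  cbeta ((ith a j)%:C - s) ((N + tail_sum a j.+1)%:C + s)
  * hyp3F2 (- nj%:R)
           (nj%:R + 2 * N + tail_sum alpha j + r%:R - j%:R + 1)%:C
           ((N + tail_sum a j.+1)%:C + s)
           (2 * N + tail_sum alpha j.+1 + r%:R - j%:R + 1)%:C
           (N + tail_sum a j)%:C
           1.

End simplex.

(* Main.v *)
(* In the coordinates u_j = (1 + tanh x_j) / 2 = logistic x_j, the simplex point is
   Upsilon_j = (1 - u_1) ... (1 - u_{j-1}) u_j, so 1 - |Upsilon_{j-1}| is the product of the
   1 - u_i with i < j and g_r splits into a product of functions of one variable.  By Fubini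
   the transform is a product of one-dimensional integrals.  In each of them
   exp (- i xi x) = u^(- i xi / 2) (1 - u)^(i xi / 2), and expanding the Jacobi polynomial in
   powers of 1 - u (Chu-Vandermonde) leaves a combination of the integrals over the line of
   u^A (1 - u)^(B + k), which the recurrence (A + B) J(A, B + 1) = B J(A, B) reduces to the
   beta integral J(A, B) = B(A, B) / 2.  The recurrence holds because the derivative of
   u^A (1 - u)^B in x is 2 (A (1 - u) - B u) u^A (1 - u)^B and has integral 0. *)

Require Import Defs.
From HB Require Import structures.
From mathcomp Require Import all_boot all_order all_algebra.
From mathcomp Require Import all_classical all_reals all_analysis.
From mathcomp Require Import complex.
From mathcomp Require Import measurable_realfun.
From mathcomp Require Import ring lra zify.

Set Implicit Arguments.
Unset Strict Implicit.
Unset Printing Implicit Defensive.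

Import Order.TTheory GRing.Theory Num.Theory.
Import numFieldNormedType.Exports.

Local Open Scope classical_set_scope.
Local Open Scope ring_scope.
Local Open Scope complex_scope.

(** * Pochhammer symbols and Jacobi polynomials *)

(** The Jacobi factor is expanded in 1 - u rather than in u because regrouping the prefactors (1 -
    |Upsilon_{j-1}|)^{n_j} puts an extra power |n^{i+1}| on 1 - u_i and none on u_i; further powers
    of 1 - u then move only the second argument of J. The Jacobi coefficients supply two upper
    parameters and one lower parameter of the 3F2. The remaining pair comes from iterating the
    recurrence: J(A, B + k) / J(A, B) = (B)_k / (A + B)_k. The frequency cancels in A + B, so this
    lower parameter is real and positive. The constant also arises coordinatewise: (1 + tanh x)^a (1
    - tanh x)^b carries 2^(a + b), and the 1/2 in J = B/2 leaves 2^(|a^j| - 1) for coordinate j.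
    Summed over j, the exponents count a_j j times for j <= r and a_{r+1} r times. On the analytic
    side one estimate does most of the work: when both exponents have positive real part the kernel
    is bounded by exp (- k |x|), which gives integrability on the line and makes the boundary terms
    vanish. Complex integrals being componentwise, this is done on real and imaginary parts, each an
    exponential times a cosine or a sine. *)

Section pochhammer_theory.

Lemma pochhammer0 (K : pzSemiRingType) (c : K) : pochhammer c 0 = 1.
Proof. by rewrite /pochhammer big_ord0. Qed.

Lemma pochhammerS (K : pzSemiRingType) (c : K) k :
  pochhammer c k.+1 = pochhammer c k * (c + k%:R).
Proof. by rewrite /pochhammer big_ord_recr. Qed.

Lemma pochhammerD (K : pzSemiRingType) (c : K) m k :
  pochhammer c (m + k) = pochhammer c m * pochhammer (c + m%:R) k.
Proof.
elim: k => [|k IH]; first by rewrite addn0 pochhammer0 mulr1.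
by rewrite addnS !pochhammerS IH mulrA natrD addrA.
Qed.

Lemma pochhammer_rev (K : comPzRingType) (c : K) k :
  pochhammer c k = \prod_(i < k) (c + k%:R - 1 - i%:R).
Proof.
rewrite /pochhammer (reindex_inj rev_ord_inj)/=; apply: eq_bigr => i _.
by rewrite natrB// -natr1; ring.
Qed.

Lemma rmorph_pochhammer (K L : pzSemiRingType) (f : {rmorphism K -> L}) c k :
  f (pochhammer c k) = pochhammer (f c) k.
Proof.
by rewrite /pochhammer rmorph_prod; apply: eq_bigr => i _; rewrite rmorphD rmorph_nat.
Qed.

(** Multiplying by (n - k)! instead of dividing keeps the identity valid in every commutative
    ring. *)
Lemma pochhammerN_nat (K : comPzRingType) (n k : nat) :
  (k <= n)%N ->
  pochhammer (- n%:R : K) k * (n - k)`!%:R = (-1) ^+ k * n`!%:R.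
Proof.
elim: k => [|k IH] kn; first by rewrite pochhammer0 subn0 expr0.
have := IH (ltnW kn).
have -> : (n - k)%N = (n - k.+1).+1 by lia.
rewrite factS natrM => E.
rewrite pochhammerS exprS -mulrA mulN1r mulNr -E.
have -> : (n - k.+1).+1%:R = n%:R - k%:R :> K by rewrite -natrB ?(ltnW kn)//; congr (_%:R); lia.
ring.
Qed.

(** The factor of index [n] is - n + n. This is what cuts the hypergeometric series off. *)
Lemma pochhammerN_eq0 (K : comPzRingType) (n k : nat) :
  (n < k)%N -> pochhammer (- n%:R : K) k = 0.
Proof.
move=> nk; rewrite /pochhammer (bigD1 (Ordinal nk))//=.
by rewrite addNr mul0r.
Qed.

Lemma pochhammer_gt0 (K : numDomainType) (c : K) k : 0 < c -> 0 < pochhammer c k.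
Proof. by move=> c0; apply: prodr_gt0 => i _; rewrite ltr_wpDr. Qed.

End pochhammer_theory.

Section jacobi_theory.
Context {R : realType}.
Implicit Types x y alpha beta v : R.

Lemma gbinom0 x : gbinom x 0 = 1.
Proof. by rewrite /gbinom big_ord0 fact0 divr1. Qed.

Lemma gbinomS x k : k.+1%:R * gbinom x k.+1 = (x - k%:R) * gbinom x k.
Proof.
rewrite /gbinom big_ord_recr/= factS natrM; field.
by rewrite nat1r !pnatr_eq0 -lt0n fact_gt0.
Qed.

Lemma gbinom_pochhammer x k : gbinom (x + k%:R - 1) k = pochhammer x k / k`!%:R.
Proof. by rewrite pochhammer_rev /gbinom. Qed.

(** Induction after scaling by [n.+1]: writing n + 1 = k + (n + 1 - k) under the sum, each part is
    absorbed by one of the two binomials through [gbinomS]. *)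
Lemma gbinom_Vandermonde x y n :
  \sum_(k < n.+1) gbinom x k * gbinom y (n - k) = gbinom (x + y) n.
Proof.
elim: n => [|n IH]; first by rewrite big_ord1 !gbinom0 mulr1.
apply: (@mulfI _ n.+1%:R); first by rewrite pnatr_eq0.
rewrite gbinomS -IH.
have -> : n.+1%:R * (\sum_(k < n.+2) gbinom x k * gbinom y (n.+1 - k)) =
    \sum_(k < n.+2) (k%:R * gbinom x k) * gbinom y (n.+1 - k) +
    \sum_(k < n.+2) gbinom x k * ((n.+1 - k)%:R * gbinom y (n.+1 - k)).
  rewrite mulr_sumr -big_split/=; apply: eq_bigr => k _.
  rewrite natrB; last by rewrite -ltnS.
  ring.
(* The first sum loses its term at 0 and the second its last one; on the common range the factors (x
   - k) and (y - (n - k)) add up to x + y - n. *)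
rewrite big_ord_recl mul0r mul0r add0r [X in _ + X]big_ord_recr/= subnn mul0r mulr0 addr0.
rewrite -big_split/= mulr_sumr; apply: eq_bigr => k _.
rewrite gbinomS subSS subSn; last by rewrite -ltnS.
by rewrite gbinomS natrB; [ring|rewrite -ltnS].
Qed.

(** Trinomial revision for a real upper argument, by induction on k - i. *)
Lemma gbinom_bin x i k : (i <= k)%N ->
  gbinom x k * 'C(k, i)%:R = gbinom x i * gbinom (x - i%:R) (k - i).
Proof.
move=> /subnK <-; move: (k - i)%N => m; rewrite addnK.
elim: m => [|m IH]; first by rewrite add0n binn gbinom0.
apply: (@mulfI _ m.+1%:R); first by rewrite pnatr_eq0.
have E : m.+1%:R * 'C(m.+1 + i, i)%:R = (m + i).+1%:R * 'C(m + i, i)%:R :> R.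
  rewrite -!natrM; congr (_%:R).
  rewrite [RHS](mul_bin_down (m + i).+1 i) addSn.
  by congr (_ * _)%N; lia.
rewrite mulrCA addSn in E *.
rewrite E mulrCA mulrA gbinomS -mulrA IH [RHS]mulrCA gbinomS natrD; ring.
Qed.

Lemma gbinom_Vandermonde_bin x y n i : (i <= n)%N ->
  \sum_(k < n.+1) gbinom x k * gbinom y (n - k) * 'C(k, i)%:R =
  gbinom x i * gbinom (x - i%:R + y) (n - i).
Proof.
move=> le_in; rewrite -gbinom_Vandermonde mulr_sumr.
rewrite -(big_mkord xpredT (fun k => gbinom x k * gbinom y (n - k) * 'C(k, i)%:R)).
rewrite (big_cat_nat (n := i))//=; last exact: leqW.
rewrite big1_seq ?add0r; last first.
  by move=> k; rewrite mem_index_iota => /andP[_ /andP[_ ki]]; rewrite bin_small ?mulr0.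
rewrite -{1}(add0n i) big_addn subSn// big_mkord; apply: eq_bigr => k _.
rewrite mulrAC gbinom_bin ?leq_addl// addnK -mulrA.
by congr (_ * (_ * gbinom _ _)); lia.
Qed.

(** The Gauss form 2F1(- n, n + alpha + beta + 1; alpha + 1; v). At x = 1 - 2v the powers of 2
    cancel and the sum consists of terms (1 - v)^k (- v)^(n - k); the coefficient of each power of v
    is then a Vandermonde sum over k. The bound on [alpha] keeps the denominators nonzero. *)
Lemma jacobi_Gauss n alpha beta v : -1 < alpha ->
  jacobi n alpha beta (1 - 2 * v) =
  pochhammer (alpha + 1) n / n`!%:R *
  \sum_(m < n.+1) pochhammer (- n%:R) m * pochhammer (n%:R + alpha + beta + 1) m
     / (pochhammer (alpha + 1) m * m`!%:R) * v ^+ m.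
Proof.
move=> alpha_gtN1.
(* The inner binomial expansion runs up to [n] instead of [k], the extra terms having 'C(k, i) = 0,
   so that the two sums can be exchanged. *)
transitivity (\sum_(k < n.+1) gbinom (n%:R + alpha) k * gbinom (n%:R + beta) (n - k)
    * \sum_(i < n.+1) (- v) ^+ (n - i) * 'C(k, i)%:R).
  rewrite /jacobi mulr_sumr; apply: eq_bigr => k _.
  have kn : (k <= n)%N by rewrite -ltnS.
  have -> : \sum_(i < n.+1) (- v) ^+ (n - i) * 'C(k, i)%:R = (1 - v) ^+ k * (- v) ^+ (n - k).
    rewrite -(big_mkord xpredT (fun i => (- v) ^+ (n - i) * 'C(k, i)%:R)).
    rewrite (big_cat_nat (n := k.+1))//= [X in _ + X]big1_seq ?addr0; last first.
      by move=> i; rewrite mem_index_iota => /andP[_ /andP[ki _]]; rewrite bin_small ?mulr0.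
    rewrite addrC exprDn big_mkord mulr_suml; apply: eq_bigr => i _.
    rewrite expr1n mulr1 mulr_natr mulrnAl -exprD; congr (_ ^+ _ *+ _).
    by have := ltn_ord i; lia.
  have -> : 1 - 2 * v + 1 = 2 * (1 - v) by ring.
  have -> : 1 - 2 * v - 1 = 2 * (- v) by ring.
  rewrite !exprMn -{1}(subnKC kn) exprD.
  field.
  by rewrite !expf_neq0.
under eq_bigr do rewrite mulr_sumr.
(* The substitution i = n - m makes [m] the power of v. *)
rewrite exchange_big (reindex_inj rev_ord_inj) mulr_sumr; apply: eq_bigr => /= m _.
rewrite subSS; have mn : (m <= n)%N by rewrite -ltnS.
rewrite subKn//.
under eq_bigr do rewrite mulrCA.
rewrite -mulr_sumr gbinom_Vandermonde_bin ?leq_subr// subKn//.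
have -> : n%:R + alpha - (n - m)%:R + (n%:R + beta) =
    (n%:R + alpha + beta + 1) + m%:R - 1 by rewrite natrB//; ring.
rewrite gbinom_pochhammer.
have -> : n%:R + alpha = (alpha + 1 + m%:R) + (n - m)%:R - 1.
  by rewrite natrB//; ring.
rewrite gbinom_pochhammer exprNn.
have /(congr1 (fun z => z / (n - m)`!%:R)) := @pochhammerN_nat R _ _ mn.
rewrite mulfK ?pnatr_eq0 -?lt0n ?fact_gt0// => ->.
have -> : pochhammer (alpha + 1) n =
    pochhammer (alpha + 1) m * pochhammer (alpha + 1 + m%:R) (n - m).
  by rewrite -pochhammerD subnKC.
field.
rewrite !pnatr_eq0 -!lt0n !fact_gt0/= ?andbT.
by rewrite gt_eqF// pochhammer_gt0// -ltrBlDr sub0r.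
Qed.

End jacobi_theory.
(** * Complex-valued integrals over products *)

Section complex_integral.
Context {R : realType}.

Lemma complex_ext (z w : R[i]) :
  complex.Re z = complex.Re w -> complex.Im z = complex.Im w -> z = w.
Proof. by case: z w => [a b] [c d] /= -> ->. Qed.

Lemma ReMc (z w : R[i]) : complex.Re (z * w) =
  complex.Re z * complex.Re w - complex.Im z * complex.Im w.
Proof. by case: z w => [a b] [c d]. Qed.

Lemma ImMc (z w : R[i]) : complex.Im (z * w) =
  complex.Re z * complex.Im w + complex.Im z * complex.Re w.
Proof. by case: z w => [a b] [c d]. Qed.

Lemma ReDc (z w : R[i]) : complex.Re (z + w) = complex.Re z + complex.Re w.
Proof. by case: z w => [a b] [c d]. Qed.

Lemma ImDc (z w : R[i]) : complex.Im (z + w) = complex.Im z + complex.Im w.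
Proof. by case: z w => [a b] [c d]. Qed.

Lemma ReNc (z : R[i]) : complex.Re (- z) = - complex.Re z.
Proof. by case: z. Qed.

Lemma natcE n : (n%:R : R[i]) = (n%:R)%:C.
Proof. by rewrite rmorph_nat. Qed.

Lemma Re_dblBM (A B K L : R[i]) : complex.Re (2 * (A * K - B * L)) =
  2 * (complex.Re A * complex.Re K - complex.Im A * complex.Im K
    - (complex.Re B * complex.Re L - complex.Im B * complex.Im L)).
Proof.
rewrite natcE; case: A B K L => [a a1] [b b1] [k k1] [l l1].
by rewrite !mulrBr; simpc; rewrite /complex.Re /complex.Im; ring.
Qed.

Lemma Im_dblBM (A B K L : R[i]) : complex.Im (2 * (A * K - B * L)) =
  2 * (complex.Re A * complex.Im K + complex.Im A * complex.Re K
    - (complex.Re B * complex.Im L + complex.Im B * complex.Re L)).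
Proof.
rewrite natcE; case: A B K L => [a a1] [b b1] [k k1] [l l1].
by rewrite !mulrBr; simpc; rewrite /complex.Re /complex.Im; ring.
Qed.

Lemma real_complexMA (x y : R) (z : R[i]) : (x * y)%:C * z = x%:C * (y%:C * z).
Proof. by rewrite rmorphM mulrA. Qed.

Lemma Re_realM (K : R[i]) s : complex.Re (s%:C * K) = s * complex.Re K.
Proof. by case: K => k k' /=; ring. Qed.

Lemma Im_realM (K : R[i]) s : complex.Im (s%:C * K) = s * complex.Im K.
Proof. by case: K => k k' /=; ring. Qed.

Definition cintegrable d (T : measurableType d) (mu : {measure set T -> \bar R})
    (D : set T) (f : T -> R[i]) : Prop :=
  mu.-integrable D (fun x => (complex.Re (f x))%:E) /\
  mu.-integrable D (fun x => (complex.Im (f x))%:E).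

Section theory.
Context d (T : measurableType d) (mu : {measure set T -> \bar R}).
Variables (D : set T) (mD : measurable D).
Implicit Types f g : T -> R[i].

Lemma cintegrableZ c f : cintegrable mu D f -> cintegrable mu D (fun x => c * f x).
Proof.
move=> [fR fI]; split.
- rewrite [X in integrable _ _ X](_ : _ =
      (fun x => (complex.Re c)%:E * (complex.Re (f x))%:E
    - (complex.Im c)%:E * (complex.Im (f x))%:E)%E).
    by apply: integrableB => //; apply: integrableZl.
  by apply/funext => x /=; rewrite ReMc EFinB !EFinM.
- rewrite [X in integrable _ _ X](_ : _ = (fun x => (complex.Re c)%:E * (complex.Im (f x))%:E
    + (complex.Im c)%:E * (complex.Re (f x))%:E)%E).
    by apply: integrableD => //; apply: integrableZl.
  by apply/funext => x /=; rewrite ImMc EFinD !EFinM.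
Qed.

Lemma cintegralZ c f : cintegrable mu D f ->
  cintegral mu D (fun x => c * f x) = c * cintegral mu D f.
Proof.
move=> [fR fI]; apply: complex_ext; rewrite /cintegral/=.
- under eq_Rintegral do rewrite ReMc.
  rewrite RintegralB//; first by rewrite !RintegralZl// ReMc.
  + exact: (@integrableZl _ _ _ _ _ mD (complex.Re c) _ fR).
  + exact: (@integrableZl _ _ _ _ _ mD (complex.Im c) _ fI).
- under eq_Rintegral do rewrite ImMc.
  rewrite RintegralD//; first by rewrite !RintegralZl// ImMc.
  + exact: (@integrableZl _ _ _ _ _ mD (complex.Re c) _ fI).
  + exact: (@integrableZl _ _ _ _ _ mD (complex.Im c) _ fR).
Qed.

Lemma cintegrableD f g : cintegrable mu D f -> cintegrable mu D g ->
  cintegrable mu D (fun x => f x + g x).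
Proof.
move=> [fR fI] [gR gI]; split.
- have := integrableD mD fR gR; congr (integrable _ _ _); apply/funext => x /=.
  by rewrite ReDc EFinD.
- have := integrableD mD fI gI; congr (integrable _ _ _); apply/funext => x /=.
  by rewrite ImDc EFinD.
Qed.

Lemma cintegralD f g : cintegrable mu D f -> cintegrable mu D g ->
  cintegral mu D (fun x => f x + g x) = cintegral mu D f + cintegral mu D g.
Proof.
move=> [fR fI] [gR gI]; apply: complex_ext; rewrite /cintegral/= -RintegralD//.
- by apply: eq_Rintegral => x _; rewrite ReDc.
- by apply: eq_Rintegral => x _; rewrite ImDc.
Qed.

Lemma cintegrable0 : cintegrable mu D (fun=> 0).
Proof. by split; exact: integrable0. Qed.

Lemma cintegral0 : cintegral mu D (fun=> 0) = 0.
Proof. by rewrite /cintegral/= /Rintegral integral0. Qed.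

Lemma cintegrable_sum n (F : nat -> T -> R[i]) :
  (forall i, (i < n)%N -> cintegrable mu D (F i)) ->
  cintegrable mu D (fun x => \sum_(i < n) F i x).
Proof.
elim: n => [_|n IH iF].
  by under eq_fun do rewrite big_ord0; exact: cintegrable0.
under eq_fun do rewrite big_ord_recr/=; apply: cintegrableD; last exact: iF.
by apply: IH => i ni; apply: iF; exact: ltnW.
Qed.

Lemma cintegral_sum n (F : nat -> T -> R[i]) :
  (forall i, (i < n)%N -> cintegrable mu D (F i)) ->
  cintegral mu D (fun x => \sum_(i < n) F i x) = \sum_(i < n) cintegral mu D (F i).
Proof.
elim: n => [_|n IH iF].
  by under eq_fun do rewrite big_ord0; rewrite big_ord0 cintegral0.
under eq_fun do rewrite big_ord_recr/=; rewrite big_ord_recr/= cintegralD; last exact: iF.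
  by rewrite IH// => i ni; apply: iF; exact: ltnW.
by apply: cintegrable_sum => i ni; apply: iF; exact: ltnW.
Qed.

Lemma eq_cintegral f g : {in D, f =1 g} -> cintegral mu D f = cintegral mu D g.
Proof.
by move=> fg; rewrite /cintegral; congr (_ +i* _);
  apply: eq_Rintegral => x xD; rewrite fg.
Qed.

End theory.

Section product.
Context d1 d2 (T1 : measurableType d1) (T2 : measurableType d2).
Variable m1 : {sigma_finite_measure set T1 -> \bar R}.
Variable m2 : {sigma_finite_measure set T2 -> \bar R}.

(** Tonelli: the iterated integral of |f| |g| is the product of two finite integrals. *)
Lemma integrable_prod_mul (f : T1 -> R) (g : T2 -> R) :
  m1.-integrable setT (EFin \o f) -> m2.-integrable setT (EFin \o g) ->
  (m1 \x m2)%E.-integrable setT (fun z : T1 * T2 => (f z.1 * g z.2)%:E).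
Proof.
move=> mf mg.
have mfg : measurable_fun [set: T1 * T2] ((fun z => (f z.1 * g z.2)%:E) : _ -> \bar R).
  apply/measurable_EFinP/measurable_funM.
  - apply: (measurableT_comp (f := f)) => //.
    by apply/measurable_EFinP; exact: measurable_int mf.
  - apply: (measurableT_comp (f := g)) => //.
    by apply/measurable_EFinP; exact: measurable_int mg.
apply/(integrable12ltyP _ _ mfg).
under eq_integral => x _.
  under eq_integral => y _ do rewrite /= normrM EFinM.
  rewrite ge0_integralZl//; last first.
    apply/measurable_EFinP; apply: measurableT_comp => //.
    by apply/measurable_EFinP; exact: measurable_int mg.
  over.
rewrite ge0_integralZr//.
- by apply: lte_mul_pinfty;
  [exact: integral_ge0 | rewrite ge0_fin_numE; [|exact: integral_ge0] |];
  [have /integrableP[_] := mf|have /integrableP[_] := mg].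
- apply/measurable_EFinP; apply: measurableT_comp => //.
  by apply/measurable_EFinP; exact: measurable_int mf.
- exact: integral_ge0.
Qed.

Lemma Rintegral_prod_mul (f : T1 -> R) (g : T2 -> R) :
  m1.-integrable setT (EFin \o f) -> m2.-integrable setT (EFin \o g) ->
  \int[(m1 \x m2)%E]_z (f z.1 * g z.2) = (\int[m1]_x f x) * \int[m2]_y g y.
Proof.
move=> mf mg; have ifg := integrable_prod_mul mf mg.
rewrite [LHS]/Rintegral -(integral12_prod_meas1 ifg) /fubini_F/=.
under eq_integral => x _.
  under eq_integral => y _ do rewrite EFinM.
  rewrite integralZl//; over.
have mg_fin : (\int[m2]_y (g y)%:E)%E \is a fin_num by exact: integrable_fin_num.
rewrite -(fineK mg_fin) integralZr// fineM//.
exact: integrable_fin_num.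
Qed.

Lemma cintegrable_prod_mul (f : T1 -> R[i]) (g : T2 -> R[i]) :
  cintegrable m1 setT f -> cintegrable m2 setT g ->
  cintegrable (m1 \x m2)%E setT (fun z => f z.1 * g z.2).
Proof.
move=> [fR fI] [gR gI]; split.
- have := integrableB measurableT (integrable_prod_mul fR gR) (integrable_prod_mul fI gI).
  by congr (integrable _ _ _); apply/funext => z /=; rewrite ReMc.
- have := integrableD measurableT (integrable_prod_mul fR gI) (integrable_prod_mul fI gR).
  by congr (integrable _ _ _); apply/funext => z /=; rewrite ImMc.
Qed.

Lemma cintegral_prod_mul (f : T1 -> R[i]) (g : T2 -> R[i]) :
  cintegrable m1 setT f -> cintegrable m2 setT g ->
  cintegral (m1 \x m2)%E setT (fun z => f z.1 * g z.2) =
  cintegral m1 setT f * cintegral m2 setT g.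
Proof.
move=> [fR fI] [gR gI]; apply: complex_ext; rewrite ?ReMc ?ImMc /cintegral/=.
- transitivity (\int[(m1 \x m2)%E]_z
      (complex.Re (f z.1) * complex.Re (g z.2) - complex.Im (f z.1) * complex.Im (g z.2))).
    by apply: eq_Rintegral => z _; rewrite ReMc.
  rewrite RintegralB//;
    [|exact: (integrable_prod_mul fR gR)|exact: (integrable_prod_mul fI gI)].
  by rewrite (Rintegral_prod_mul fR gR) (Rintegral_prod_mul fI gI).
- transitivity (\int[(m1 \x m2)%E]_z
      (complex.Re (f z.1) * complex.Im (g z.2) + complex.Im (f z.1) * complex.Re (g z.2))).
    by apply: eq_Rintegral => z _; rewrite ImMc.
  rewrite RintegralD//;
    [|exact: (integrable_prod_mul fR gI)|exact: (integrable_prod_mul fI gR)].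
  by rewrite (Rintegral_prod_mul fR gI) (Rintegral_prod_mul fI gR).
Qed.

End product.

Section pushforward.
Context d1 d2 (X : measurableType d1) (Y : measurableType d2).
Variables (phi : X -> Y) (mphi : measurable_fun setT phi).
Variables (mu : {measure set X -> \bar R}) (nu : {measure set Y -> \bar R}).
Hypothesis nuE : nu = pushforward mu phi :> (set Y -> \bar R).

(** [nuE] equates only the underlying set functions, because [cons_measure] is a pushforward
    equipped with its own measure structure; integrals for the two structures are compared by
    [eq_measure_integral]. *)
Lemma cintegrable_pushforward (f : Y -> R[i]) :
  measurable_fun setT (fun x => complex.Re (f x)) ->
  measurable_fun setT (fun x => complex.Im (f x)) ->
  cintegrable mu setT (f \o phi) -> cintegrable nu setT f.
Proof.
move=> mR mI [iR iI].
have E (g : Y -> R) : measurable_fun setT g -> mu.-integrable setT (EFin \o (g \o phi)) ->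
    nu.-integrable setT (EFin \o g).
  move=> mg ig; apply/integrableP; split; first exact/measurable_EFinP.
  have /integrableP[_] : (pushforward mu phi).-integrable setT (EFin \o g).
    by apply: integrable_pushforward => //; exact/measurable_EFinP.
  congr (_ < _)%E; apply: eq_measure_integral => A mA _ /=.
  by rewrite nuE.
by split; exact: E.
Qed.

Lemma cintegral_pushforward (f : Y -> R[i]) :
  measurable_fun setT (fun x => complex.Re (f x)) ->
  measurable_fun setT (fun x => complex.Im (f x)) ->
  cintegrable mu setT (f \o phi) ->
  cintegral nu setT f = cintegral mu setT (f \o phi).
Proof.
move=> mR mI [iR iI].
have E (g : Y -> R) : measurable_fun setT g -> mu.-integrable setT (EFin \o (g \o phi)) ->
    \int[nu]_x g x = \int[mu]_x g (phi x).
  move=> mg ig; rewrite /Rintegral; congr fine.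
  rewrite (eq_measure_integral (pushforward mu phi)); last by move=> A mA _ /=; rewrite nuE.
  by rewrite integral_pushforward//; exact/measurable_EFinP.
by rewrite /cintegral; congr (_ +i* _); exact: E.
Qed.

End pushforward.

Local Notation leb := (@lebesgue_measure R).

(** Fubini for separated variables, by induction on [n] from the Dirac mass at the empty tuple.
    Integrability and value go together, since the step for the value needs the tail to be
    integrable. *)
Lemma cintegral_lebesgue_tuple n (F : nat -> R -> R[i]) :
  (forall i, (i < n)%N -> cintegrable leb setT (F i)) ->
  cintegrable (lebesgue_tuple n) setT (fun x : n.-tuple R => \prod_(i < n) F i x`_i) /\
  cintegral (lebesgue_tuple n) setT (fun x : n.-tuple R => \prod_(i < n) F i x`_i)
    = \prod_(i < n) cintegral leb setT (F i).
Proof.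
elim: n F => [|n IH] F iF.
  split.
    split; apply/integrableP; split => //.
    - by under eq_fun do rewrite big_ord0; exact: measurable_cst.
    - rewrite integral_dirac//= ?diracT ?mul1e ?ltry//.
      by under eq_fun do rewrite big_ord0; exact: measurable_cst.
    - by under eq_fun do rewrite big_ord0; exact: measurable_cst.
    - rewrite integral_dirac//= ?diracT ?mul1e ?ltry//.
      by under eq_fun do rewrite big_ord0; exact: measurable_cst.
  rewrite big_ord0 /cintegral/= /Rintegral.
  under [X in fine X +i* _]eq_integral do rewrite big_ord0.
  under [X in _ +i* fine X]eq_integral do rewrite big_ord0.
  by rewrite !integral_dirac// diracT !mul1e.
have [iG IG] := IH (fun i => F i.+1) (fun i ni => iF i.+1 ni).
set G := (fun x : n.-tuple R => \prod_(i < n) F i.+1 x`_i) in iG IG.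
have iF0 := iF 0%N erefl.
set H := (fun x : n.+1.-tuple R => \prod_(i < n.+1) F i x`_i).
have HE y : H y = F 0%N (tnth y ord0) * G [tuple of behead y].
  rewrite /H big_ord_recl (tnth_nth 0); congr (_ * _).
  by apply: eq_bigr => i _ /=; rewrite nth_behead.
have Hcons : H \o @cons_pair _ (measurableTypeR R) n = fun z => F 0%N z.1 * G z.2.
  apply/funext => -[x t] /=; rewrite HE; congr (_ * G _).
  exact/val_inj.
(* The transfer along [cons_pair] asks for measurability of the function on tuples itself, not only
   of its composite with [cons_pair]. *)
have mFG (f : R -> R) (g : n.-tuple R -> R) :
    leb.-integrable setT (EFin \o f) -> (lebesgue_tuple n).-integrable setT (EFin \o g) ->
    measurable_fun [set: n.+1.-tuple (measurableTypeR R)]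
      (fun y => f (tnth y ord0) * g [tuple of behead y]).
  move=> mf mg; apply: measurable_funM.
  - apply: (measurableT_comp (f := f)); last exact: measurable_tnth.
    by apply/measurable_EFinP; exact: measurable_int mf.
  - apply: (measurableT_comp (f := g)); last exact: measurable_behead.
    by apply/measurable_EFinP; exact: measurable_int mg.
have [F0R F0I] := iF0; have [GR GI] := iG.
have mHR : measurable_fun [set: n.+1.-tuple (measurableTypeR R)] (fun y => complex.Re (H y)).
  under eq_fun do rewrite HE ReMc.
  exact: (measurable_funB (mFG _ _ F0R GR) (mFG _ _ F0I GI)).
have mHI : measurable_fun [set: n.+1.-tuple (measurableTypeR R)] (fun y => complex.Im (H y)).
  under eq_fun do rewrite HE ImMc.
  exact: (measurable_funD (mFG _ _ F0R GI) (mFG _ _ F0I GR)).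
have iH : cintegrable (leb \x lebesgue_tuple n)%E setT (H \o @cons_pair _ (measurableTypeR R) n).
  by rewrite Hcons; exact: cintegrable_prod_mul.
split.
  by apply: cintegrable_pushforward mHR mHI iH => //; exact: measurable_cons_pair.
rewrite (cintegral_pushforward _ _ mHR mHI iH)//; last exact: measurable_cons_pair.
by rewrite Hcons cintegral_prod_mul// IG big_ord_recl.
Qed.

End complex_integral.
(** * Integrals over the line and over (0, 1) *)

Section improper_integrals.
Context {R : realType}.
Local Notation leb := (@lebesgue_measure R).

(** The fundamental theorem on growing symmetric intervals, followed by dominated convergence with
    bound |f|. *)
Lemma integral_derive_eq0 (F f : R -> R) :
  (forall x : R, is_derive x 1 F (f x)) -> continuous f ->
  leb.-integrable setT (EFin \o f) ->
  F n%:R @[n --> \oo] --> 0 -> F (- n%:R) @[n --> \oo] --> 0 ->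
  \int[leb]_x f x = 0.
Proof.
move=> dF cf intf Fy FNy.
have cF : continuous F.
  move=> x; apply: differentiable_continuous; apply/derivable1_diffP.
  by case: (dF x).
(* The successor keeps the interval nondegenerate at n = 0, as [continuous_FTC2] requires. *)
pose A (n : nat) : set R := [set` `[- n.+1%:R, n.+1%:R]].
have mf : measurable_fun setT (EFin \o f) by exact: measurable_int intf.
have fA n : (\int[leb]_x ((EFin \o f) \_ (A n)) x = (F n.+1%:R - F (- n.+1%:R))%:E)%E.
  rewrite -integral_mkcond (@continuous_FTC2 _ f F)//.
  - by rewrite gtrN.
  - exact: continuous_subspaceT.
  - split.
    + by move=> x _; case: (dF x).
    + exact/cvg_at_right_filter/cF.
    + exact/cvg_at_left_filter/cF.
  - by move=> x _; rewrite derive1E; case: (dF x).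
have cv0 : (\int[leb]_x ((EFin \o f) \_ (A n)) x @[n --> \oo] --> 0)%E.
  under eq_fun do rewrite fA.
  apply/fine_cvgP; split; first exact: nearW.
  rewrite -[X in _ --> X](subr0 0); apply: cvgB.
    by rewrite (cvg_shiftS (fun n : nat => F n%:R)).
  by rewrite (cvg_shiftS (fun n : nat => F (- n%:R))).
rewrite /Rintegral -[RHS]/(fine 0%E); congr fine.
apply: cvg_unique cv0 => //.
have [|||||_ _] := @dominated_convergence _ _ _ leb setT measurableT
  (fun n => (EFin \o f) \_ (A n)) (EFin \o f) (abse \o (EFin \o f)).
- move=> n; apply/(measurable_restrictT (EFin \o f)); first exact: measurable_itv.
  exact: measurable_funS mf.
- by [].
- apply/nearW => x _; apply: cvg_near_cst.
  near=> n; rewrite patchE ifT// inE /A/= in_itv/= -ler_norml.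
  by near: n; have := nbhs_infty_ger `|x|; apply: filterS => n /le_trans; apply; rewrite ler_nat.
- exact: integrable_abse.
- apply/nearW => x n _; rewrite patchE; case: ifP => // _.
  by apply: le_trans (abse_ge0 _); rewrite -[point]/(0%E) abse0.
- by [].
Unshelve. all: by end_near.
Qed.

Section substitution.
Variables s s' : R -> R.
Hypotheses (ds : forall x : R, is_derive x 1 s (s' x)) (cs' : continuous s').
Hypotheses (s_incr : {homo s : x y / x < y}) (s01 : forall x, 0 < s x < 1).
Hypotheses (sy : s n%:R @[n --> \oo] --> (1 : R)).
Hypotheses (sNy : s (- n%:R) @[n --> \oo] --> (0 : R)).

Let s'E : s^`()%classic = s'.
Proof. by apply/funext => x; rewrite derive1E; case: (ds x). Qed.

Let cs : continuous s.
Proof.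
move=> x; apply: differentiable_continuous; apply/derivable1_diffP.
by case: (ds x).
Qed.

Let s'_ge0 x : 0 <= s' x.
Proof.
rewrite -s'E; apply: (@incr_derive1_ge0 _ s setT).
- by move=> y _; case: (ds y).
- by move=> y z _ _; exact: s_incr.
- by rewrite interiorT.
Qed.

(** Change of variables on the compact intervals [s (- n), s n] and [- n, n], then monotone
    convergence on both sides. Continuity is asked only inside (0, 1), so [G] may blow up at the
    endpoints, as a beta integrand can. *)
Let ge0_integral_substitution (G : R -> R) :
  (forall t : R, 0 < t < 1 -> {for t, continuous G}) ->
  (forall t, 0 <= G t) ->
  (\int[leb]_(t in `]0%R, 1%R[) (G t)%:E = \int[leb]_x (G (s x) * s' x)%:E)%E.
Proof.
move=> cG G0.
pose A (n : nat) : set R := [set` `[s (- n%:R), s n%:R]].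
pose B (n : nat) : set R := [set` `[- n%:R, n%:R]].
have BE : \bigcup_n B n = setT by exact: bigcup_itvT.
have s_le x y : x <= y -> s x <= s y.
  by rewrite le_eqVlt => /predU1P[->//|/s_incr/ltW].
have A01 n t : A n t -> 0 < t < 1.
  rewrite /A/= in_itv/= => /andP[lt tu].
  by have /andP[h1 _] := s01 (- n%:R); have /andP[_ h2] := s01 n%:R;
    rewrite (lt_le_trans h1)// (le_lt_trans tu).
have AE : \bigcup_n A n = `]0%R, 1%R[%classic.
  apply/seteqP; split => [t [n _ Ant]|t].
    by rewrite /= in_itv/=; exact: A01 Ant.
  rewrite /= in_itv/= => /andP[t0 t1].
  have [n [sn1 sn2]] : exists n : nat, s (- n%:R) <= t /\ t <= s n%:R.
    near (\oo) => n; exists n; split.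
    + near: n.
      by apply: (cvgr_le _ sNy).
    + by near: n; apply: (cvgr_ge _ sy).
  by exists n => //; rewrite /A/= in_itv/= sn1 sn2.
have cGs : continuous (fun x => G (s x) * s' x).
  move=> x; apply: cvgM; last exact: cs'.
  by apply: continuous_comp; [exact: cs|exact: cG].
have cvA : (\int[leb]_(t in A n) (G t)%:E @[n --> \oo] -->
    \int[leb]_(t in `]0%R, 1%R[) (G t)%:E)%E.
  rewrite -AE; apply: ge0_nondecreasing_set_cvg_integral.
  - apply/nondecreasing_seqP => n; apply/subsetPset => t; rewrite /A/= !in_itv/= => /andP[h1 h2].
    by rewrite (le_trans _ h1) ?(le_trans h2)// s_le// ?lerN2 ler_nat.
  - by move=> n; exact: measurable_itv.
  - move=> n; apply/measurable_EFinP.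
    apply: subspace_continuous_measurable_fun; first exact: measurable_itv.
    apply: continuous_in_subspaceT => t; rewrite inE => /A01; exact: cG.
  - by move=> n t _; rewrite lee_fin.
have cvB : (\int[leb]_(x in B n) (G (s x) * s' x)%:E @[n --> \oo] -->
    \int[leb]_x (G (s x) * s' x)%:E)%E.
  rewrite -BE; apply: ge0_nondecreasing_set_cvg_integral.
  - apply/nondecreasing_seqP => n; apply/subsetPset => t; rewrite /B/= !in_itv/= => /andP[h1 h2].
    by rewrite (le_trans _ h1) ?(le_trans h2)// ?lerN2 ler_nat.
  - by move=> n; exact: measurable_itv.
  - move=> n; apply/measurable_EFinP; apply: measurable_funTS.
    exact: continuous_measurable_fun.
  - by move=> n t _; rewrite lee_fin mulr_ge0.
apply: cvg_unique cvA _ => //.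
apply: cvg_trans cvB; apply: near_eq_cvg; apply: nearW => n.
rewrite integration_by_substitution_increasing ?s'E//.
- by rewrite (@le_trans _ _ 0)// oppr_le0.
- by move=> x y _ _; exact: s_incr.
- by apply/cvg_ex; exists (s' (- n%:R)); exact/cvg_at_right_filter/cs'.
- by apply/cvg_ex; exists (s' n%:R); exact/cvg_at_left_filter/cs'.
- split.
  + by move=> x _; case: (ds x).
  + exact/cvg_at_right_filter/cs.
  + exact/cvg_at_left_filter/cs.
- by apply: continuous_in_subspaceT => t; rewrite inE => /(A01 n); exact: cG.
Unshelve. all: by end_near.
Qed.

(** Positive and negative parts are treated separately: since s' >= 0, multiplying by it commutes
    with taking either part. The equality lives in the extended reals, so no integrability
    enters. *)
Lemma integral_substitution_oo01 (G : R -> R) :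
  (forall t : R, 0 < t < 1 -> {for t, continuous G}) ->
  (\int[leb]_(t in `]0%R, 1%R[) (G t)%:E = \int[leb]_x (G (s x) * s' x)%:E)%E.
Proof.
move=> cG.
rewrite [LHS]integralE [RHS]integralE; congr (_ - _)%E.
- transitivity (\int[leb]_(t in `]0%R, 1%R[) (Num.max (G t) 0)%:E)%E.
    by apply: eq_integral => t _; rewrite funeposE EFin_max.
  rewrite ge0_integral_substitution.
  + apply: eq_integral => x _.
    by rewrite maxr_pMl// mul0r funeposE EFin_max.
  + by move=> t t01; apply: continuous_max; [exact: cG|exact: cst_continuous].
  + by move=> t; rewrite le_max lexx orbT.
- transitivity (\int[leb]_(t in `]0%R, 1%R[) (Num.max (- G t) 0)%:E)%E.
    by apply: eq_integral => t _; rewrite funenegE EFin_max.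
  rewrite ge0_integral_substitution.
  + apply: eq_integral => x _.
    by rewrite maxr_pMl// mul0r mulNr funenegE EFin_max.
  + by move=> t t01; apply: continuous_max; [apply: cvgN; exact: cG|exact: cst_continuous].
  + by move=> t; rewrite le_max lexx orbT.
Qed.

End substitution.

End improper_integrals.

(** * The logistic coordinate and the exponential decay of its powers *)

Section logistic.
Context {R : realType}.
Implicit Types (x y : R).

Definition logistic x : R := (1 + tanh x) / 2.

Lemma logisticE x : logistic x = (1 + expR (- (2 * x)))^-1.
Proof.
have -> : - (2 * x) = - x + - x by ring.
rewrite /logistic /tanh expRD !expRN.
field.
by rewrite ?gt_eqF ?expR_gt0 ?addr_gt0 ?invr_gt0 ?mulr_gt0 ?expR_gt0.
Qed.

Lemma logistic_gt0 x : 0 < logistic x.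
Proof. by rewrite logisticE invr_gt0 addr_gt0// expR_gt0. Qed.

Lemma logisticN x : logistic (- x) = 1 - logistic x.
Proof.
rewrite !logisticE mulrN opprK expRN; field.
by rewrite ?gt_eqF ?expR_gt0 ?addr_gt0 ?expR_gt0.
Qed.

Lemma logistic_lt1 x : logistic x < 1.
Proof. by rewrite -subr_gt0 -logisticN logistic_gt0. Qed.

Lemma logistic01 x : 0 < logistic x < 1.
Proof. by rewrite logistic_gt0 logistic_lt1. Qed.

(** The odds u / (1 - u) are exp (2 x), the link between the Fourier character and powers of u and 1
    - u. *)
Lemma logistic_ratio x : logistic x = expR (2 * x) * logistic (- x).
Proof.
rewrite !logisticE mulrN opprK expRN; field.
by rewrite ?gt_eqF ?expR_gt0 ?addr_gt0 ?expR_gt0.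
Qed.

Lemma logistic_mono : {homo logistic : x y / x < y}.
Proof.
move=> x y xy; rewrite !logisticE ltf_pV2 ?posrE ?addr_gt0 ?expR_gt0//.
by rewrite ltrD2l ltr_expR ltrN2 ltr_pM2l.
Qed.

Lemma is_derive_logistic x : is_derive x 1 logistic (2 * logistic x * logistic (- x)).
Proof.
have -> : logistic = (fun y => (1 + expR (- (2 * y)))^-1).
  by apply/funext => y; exact: logisticE.
have dexp : is_derive x 1 (fun y : R => 1 + expR (- (2 * y))) (- (2 * expR (- (2 * x)))).
  have h : is_derive x 1 (fun y : R => - (2 * y)) (- 2).
    by apply: is_derive_eq; rewrite scaler1.
  have h' := @is_derive1_comp _ expR (fun y => - (2 * y)) _ _ _ (is_derive_expR _) h.
  apply: is_derive_eq.
  by ring.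
have ne0 : 1 + expR (- (2 * x)) != 0 by rewrite gt_eqF// addr_gt0// expR_gt0.
apply: (is_derive_eq (@is_deriveV _ (fun y => 1 + expR (- (2 * y))) _ _ _ ne0 dexp)).
rewrite mulrN opprK expRN /GRing.scale/=; field.
by rewrite ?gt_eqF ?expR_gt0 ?addr_gt0 ?expR_gt0.
Qed.

Lemma continuous_logistic : continuous logistic.
Proof.
move=> x; apply: differentiable_continuous; apply/derivable1_diffP.
by case: (is_derive_logistic x).
Qed.

Lemma logistic_Nnat_cvg : logistic (- n%:R) @[n --> \oo] --> (0 : R).
Proof.
apply: (@squeeze_cvgr _ _ _ _ (fun=> 0) (fun n : nat => expR (- n%:R))).
- apply: nearW => n; rewrite ltW ?logistic_gt0//=.
  (* The available bound exp (- 2 n) is weakened to exp (- n), the form of [cvgn_expR]. *)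
  rewrite logistic_ratio opprK -[leRHS]mulr1 ler_pM ?expR_ge0 ?(ltW (logistic_gt0 _))//.
    by rewrite ler_expR mulrN lerN2 ler_peMl// ler1n.
  exact/ltW/logistic_lt1.
- exact: cvg_cst.
- exact: cvgn_expR.
Qed.

Lemma logistic_nat_cvg : logistic n%:R @[n --> \oo] --> (1 : R).
Proof.
have -> : (fun n : nat => logistic n%:R) = (fun n => 1 - logistic (- n%:R)).
  by apply/funext => n; rewrite logisticN subKr.
rewrite -[X in _ --> X]subr0; apply: cvgB; first exact: cvg_cst.
exact: logistic_Nnat_cvg.
Qed.

Definition lnlogistic x : R := ln (logistic x).

Lemma expR_lnlogistic x : expR (lnlogistic x) = logistic x.
Proof. by rewrite lnK// posrE logistic_gt0. Qed.

Lemma lnlogistic_le0 x : lnlogistic x <= 0.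
Proof. by rewrite -ler_expR expR_lnlogistic expR0 ltW// logistic_lt1. Qed.

Lemma lnlogisticB x : lnlogistic x = 2 * x + lnlogistic (- x).
Proof. by apply: expR_inj; rewrite expRD !expR_lnlogistic -logistic_ratio. Qed.

Lemma is_derive_lnlogistic x : is_derive x 1 lnlogistic (2 * logistic (- x)).
Proof.
have -> : lnlogistic = (@ln R) \o logistic by [].
apply: is_derive_eq.
  exact: (is_derive1_comp (is_derive1_ln (logistic_gt0 x)) (is_derive_logistic x)).
by field; rewrite gt_eqF// logistic_gt0.
Qed.

(* logistic x ^ u * (1 - logistic x) ^ v = exp (blend u v x) *)
Definition blend (u v x : R) : R := u * lnlogistic x + v * lnlogistic (- x).

Lemma is_derive_blend u v x :
  is_derive x 1 (blend u v) (2 * (u * logistic (- x) - v * logistic x)).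
Proof.
have h : is_derive x 1 (lnlogistic \o -%R) (2 * logistic (- - x) * (- 1)).
  exact: (@is_derive1_comp _ lnlogistic -%R _ _ _ (is_derive_lnlogistic _) (is_deriveNid _ _)).
have h' := is_derive_lnlogistic x.
apply: is_derive_eq.
rewrite opprK /GRing.scale/=; ring.
Qed.

(** Both logarithms are nonpositive and differ by 2 x. For x >= 0 the second is at most - 2 x, so
    its term alone gives - 2 v |x|; for x < 0 the first one gives - 2 u |x|. *)
Lemma blend_le u v k x : 0 < k -> k <= 2 * u -> k <= 2 * v ->
  blend u v x <= - (k * `|x|).
Proof.
move=> k0 ku kv; have := lnlogistic_le0 x; have := lnlogistic_le0 (- x).
have := lnlogisticB x; rewrite /blend.
set s := lnlogistic x; set t := lnlogistic (- x) => E t0 s0.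
have u0 : 0 < u by rewrite -(pmulr_rgt0 (x := 2))//; lra.
have v0 : 0 < v by rewrite -(pmulr_rgt0 (x := 2))//; lra.
have [x0|x0] := leP 0 x.
  have := mulr_ge0_le0 (ltW u0) s0.
  have := mulr_ge0_le0 (ltW v0) s0.
  have := ler_wpM2r x0 kv.
  have -> : t = s - 2 * x by lra.
  by rewrite (ger0_norm x0); nra.
have := mulr_ge0_le0 (ltW u0) t0.
have := mulr_ge0_le0 (ltW v0) t0.
have := ler_wnM2r (ltW x0) ku.
by rewrite E (ltr0_norm x0); nra.
Qed.

End logistic.

Section exponential_decay.
Context {R : realType}.
Local Notation leb := (@lebesgue_measure R).

Lemma integrable_expR_abs (k : R) : 0 < k ->
  leb.-integrable setT (fun x => (expR (- (k * `|x|)))%:E).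
Proof.
move=> k0.
have ce : continuous (fun x : R => expR (- (k * `|x|))).
  move=> x; apply: continuous_comp; last exact: continuous_expR.
  apply: cvgN; apply: cvgM; first exact: cvg_cst.
  exact: norm_continuous.
apply/integrableP; split.
  by apply/measurable_EFinP; exact: continuous_measurable_fun.
under eq_integral => x _ do rewrite /= ger0_norm ?expR_ge0//.
rewrite ge0_symfun_integralT//=; last by move=> x /=; rewrite normrN.
have -> : [set x : R | 0 <= x] = [set` `[0, +oo[].
  by apply/seteqP; split => x /=; rewrite in_itv/= andbT.
under eq_integral => x.
  rewrite inE/= in_itv/= andbT => x0; rewrite (ger0_norm x0); over.
have dE (x : R) : is_derive x 1 (fun x : R => - k^-1 * expR (- (k * x))) (expR (- (k * x))).
  have h : is_derive x 1 (fun y : R => - (k * y)) (- k).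
    by apply: is_derive_eq; rewrite scaler1.
  have h' := @is_derive1_comp _ expR (fun y => - (k * y)) _ _ _ (is_derive_expR _) h.
  apply: is_derive_eq.
  by rewrite /GRing.scale/=; field; rewrite gt_eqF.
have cF : continuous (fun x : R => - k^-1 * expR (- (k * x))).
  move=> x; apply: differentiable_continuous; apply/derivable1_diffP.
  by case: (dE x).
rewrite (@ge0_continuous_FTC2y _ _ (fun x => - k^-1 * expR (- (k * x))) 0 0).
- by rewrite -EFinB -EFinM ltry.
- by move=> x _; exact: expR_ge0.
- apply: continuous_subspaceT => x; apply: continuous_comp; last exact: continuous_expR.
  by apply: cvgN; apply: cvgM; [exact: cvg_cst|exact: cvg_id].
- rewrite -[X in _ --> X](mulr0 (- k^-1)); apply: cvgM; first exact: cvg_cst.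
  apply: (@cvg_comp _ _ _ (fun x : R => k * x) (fun z => expR (- z)) _ (pinfty_nbhs R));
    last exact: cvgr_expR.
  exact: gt0_cvgMry.
- by move=> x _; case: (dE x).
- by apply: cvg_at_right_filter; exact: cF.
- by move=> x _; rewrite derive1E; case: (dE x).
Qed.

Lemma integrable_le_expR_abs (f : R -> R) (k : R) : 0 < k -> continuous f ->
  (forall x, `|f x| <= expR (- (k * `|x|))) ->
  leb.-integrable setT (fun x => (f x)%:E).
Proof.
move=> k0 cf fk; apply: le_integrable (integrable_expR_abs k0) => //.
- by apply/measurable_EFinP; exact: continuous_measurable_fun.
- by move=> x _ /=; rewrite lee_fin (le_trans (fk x))// ler_norm.
Qed.

(** Supplies the two boundary limits required by [integral_derive_eq0]. *)
Lemma expR_abs_decay (f : R -> R) (k : R) : 0 < k ->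
  (forall x, `|f x| <= expR (- (k * `|x|))) ->
  f n%:R @[n --> \oo] --> 0 /\ f (- n%:R) @[n --> \oo] --> 0.
Proof.
move=> k0 fk.
have e0 : expR (- (k * n%:R)) @[n --> \oo] --> (0 : R).
  apply: (@cvg_comp _ _ _ (fun n : nat => n%:R) (fun z : R => expR (- (k * z))) _ (pinfty_nbhs R)).
    exact: cvgr_idn.
  apply: (@cvg_comp _ _ _ (fun x : R => k * x) (fun z => expR (- z)) _ (pinfty_nbhs R));
    last exact: cvgr_expR.
  exact: gt0_cvgMry.
have e0N : - expR (- (k * n%:R)) @[n --> \oo] --> (0 : R).
  by rewrite -oppr0; apply: cvgN.
split; apply: squeeze_cvgr e0N e0; apply: nearW => n; rewrite -ler_norml.
- by have := fk n%:R; rewrite normr_nat.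
- by have := fk (- n%:R); rewrite normrN normr_nat.
Qed.

End exponential_decay.

(** * The beta integral as an integral over the line *)

Section complex_powers.
Context {R : realType}.
Implicit Types (z w A B : R[i]) (s t x : R).

Lemma cexpD z w : cexp (z + w) = cexp z * cexp w.
Proof.
apply: complex_ext; rewrite /cexp ReDc ImDc ?ReMc ?ImMc/= expRD ?cosD ?sinD; ring.
Qed.

Lemma cexp_real x : cexp x%:C = (expR x)%:C.
Proof. by apply: complex_ext; rewrite /cexp ?ReMc ?ImMc/= cos0 sin0; ring. Qed.

Lemma cexp0 : cexp (0 : R[i]) = 1.
Proof. by rewrite -[0]/(0%:C) cexp_real expR0. Qed.

Lemma cexp_sum n (F : 'I_n -> R[i]) : cexp (\sum_i F i) = \prod_i cexp (F i).
Proof. by elim/big_rec2: _ => [|i y z _ <-]; [exact: cexp0|exact: cexpD]. Qed.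

Lemma cpowerD t z w : cpower t (z + w) = cpower t z * cpower t w.
Proof. by rewrite /cpower mulrDl cexpD. Qed.

Lemma cpower_real t x : 0 < t -> cpower t x%:C = (t `^ x)%:C.
Proof. by move=> t0; rewrite /cpower -rmorphM cexp_real /powR gt_eqF. Qed.

Lemma cpower1 t : 0 < t -> cpower t 1 = t%:C.
Proof. by move=> t0; rewrite -[1]/(1%:C) cpower_real// powRr1// ltW. Qed.

Lemma cpower_nat t n : 0 < t -> cpower t n%:R = (t ^+ n)%:C.
Proof. by move=> t0; rewrite -(rmorph_nat (real_complex R)) cpower_real// powR_mulrn// ltW. Qed.

Lemma cpowerM_Re s t A B : complex.Re (cpower s A * cpower t B) =
  expR (complex.Re A * ln s + complex.Re B * ln t) *
  cos (complex.Im A * ln s + complex.Im B * ln t).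
Proof.
rewrite -cexpD /cexp !(ReDc, ImDc, ReMc, ImMc)/= mul0r subr0.
by congr (expR _ * cos _); ring.
Qed.

Lemma cpowerM_Im s t A B : complex.Im (cpower s A * cpower t B) =
  expR (complex.Re A * ln s + complex.Re B * ln t) *
  sin (complex.Im A * ln s + complex.Im B * ln t).
Proof.
rewrite -cexpD /cexp !(ReDc, ImDc, ReMc, ImMc)/= mul0r addr0.
by congr (expR _ * sin _); ring.
Qed.

End complex_powers.

Section beta_integral.
Context {R : realType}.
Local Notation leb := (@lebesgue_measure R).
Implicit Types (A B : R[i]) (x : R).

(** The integrand u^A (1 - u)^B of J(A, B). Writing 1 - u as [logistic (- x)] makes both logarithms
    instances of [lnlogistic]. *)
Definition beta_kernel A B x : R[i] :=
  cpower (logistic x) A * cpower (logistic (- x)) B.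

Lemma beta_kernel_Re A B x : complex.Re (beta_kernel A B x) =
  expR (blend (complex.Re A) (complex.Re B) x) *
  cos (blend (complex.Im A) (complex.Im B) x).
Proof. exact: cpowerM_Re. Qed.

Lemma beta_kernel_Im A B x : complex.Im (beta_kernel A B x) =
  expR (blend (complex.Re A) (complex.Re B) x) *
  sin (blend (complex.Im A) (complex.Im B) x).
Proof. exact: cpowerM_Im. Qed.

Lemma beta_kernelD A B A' B' x :
  beta_kernel (A + A') (B + B') x = beta_kernel A B x * beta_kernel A' B' x.
Proof. by rewrite /beta_kernel !cpowerD; ring. Qed.

Lemma beta_kernelSr A B x :
  beta_kernel A (B + 1) x = (logistic (- x))%:C * beta_kernel A B x.
Proof. by rewrite /beta_kernel cpowerD (cpower1 (logistic_gt0 _)); ring. Qed.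

Lemma beta_kernelSl A B x :
  beta_kernel (A + 1) B x = (logistic x)%:C * beta_kernel A B x.
Proof. by rewrite /beta_kernel cpowerD (cpower1 (logistic_gt0 _)); ring. Qed.

(** Differentiating the exponential and the cosine brings out the derivatives of two blends; their
    factors [logistic (- x)] and [logistic x] are absorbed as unit shifts of [B] and [A]. *)
Lemma is_derive_beta_kernel_Re A B x :
  is_derive x 1 (fun x => complex.Re (beta_kernel A B x))
    (complex.Re (2 * (A * beta_kernel A (B + 1) x - B * beta_kernel (A + 1) B x))).
Proof.
rewrite (_ : (fun x => _) = (fun x => expR (blend (complex.Re A) (complex.Re B) x) *
  cos (blend (complex.Im A) (complex.Im B) x))); last first.
  by apply/funext => y; rewrite beta_kernel_Re.
have h1 := @is_derive1_comp _ expR (blend (complex.Re A) (complex.Re B)) x _ _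
  (is_derive_expR _) (is_derive_blend _ _ _).
have h2 := @is_derive1_comp _ cos (blend (complex.Im A) (complex.Im B)) x _ _
  (is_derive_cos _) (is_derive_blend _ _ _).
apply: is_derive_eq.
rewrite beta_kernelSr beta_kernelSl Re_dblBM !Re_realM !Im_realM.
rewrite beta_kernel_Re beta_kernel_Im /GRing.scale/=; ring.
Qed.

Lemma is_derive_beta_kernel_Im A B x :
  is_derive x 1 (fun x => complex.Im (beta_kernel A B x))
    (complex.Im (2 * (A * beta_kernel A (B + 1) x - B * beta_kernel (A + 1) B x))).
Proof.
rewrite (_ : (fun x => _) = (fun x => expR (blend (complex.Re A) (complex.Re B) x) *
  sin (blend (complex.Im A) (complex.Im B) x))); last first.
  by apply/funext => y; rewrite beta_kernel_Im.
have h1 := @is_derive1_comp _ expR (blend (complex.Re A) (complex.Re B)) x _ _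
  (is_derive_expR _) (is_derive_blend _ _ _).
have h2 := @is_derive1_comp _ sin (blend (complex.Im A) (complex.Im B)) x _ _
  (is_derive_sin _) (is_derive_blend _ _ _).
apply: is_derive_eq.
rewrite beta_kernelSr beta_kernelSl Im_dblBM !Re_realM !Im_realM.
rewrite beta_kernel_Re beta_kernel_Im /GRing.scale/=; ring.
Qed.

Lemma continuous_beta_kernel_Re A B : continuous (fun x => complex.Re (beta_kernel A B x)).
Proof.
move=> x; apply: differentiable_continuous; apply/derivable1_diffP.
by case: (is_derive_beta_kernel_Re A B x).
Qed.

Lemma continuous_beta_kernel_Im A B : continuous (fun x => complex.Im (beta_kernel A B x)).
Proof.
move=> x; apply: differentiable_continuous; apply/derivable1_diffP.
by case: (is_derive_beta_kernel_Im A B x).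
Qed.

Lemma beta_kernel_decay A B : 0 < complex.Re A -> 0 < complex.Re B ->
  exists2 k : R, 0 < k & forall x,
    `|complex.Re (beta_kernel A B x)| <= expR (- (k * `|x|)) /\
    `|complex.Im (beta_kernel A B x)| <= expR (- (k * `|x|)).
Proof.
(* The largest rate that [blend_le] allows; the oscillating factor is bounded by 1. *)
move=> A0 B0; pose k := 2 * Num.min (complex.Re A) (complex.Re B).
have k0 : 0 < k by rewrite mulr_gt0// lt_min A0.
have kA : k <= 2 * complex.Re A by rewrite ler_pM2l// ge_min lexx.
have kB : k <= 2 * complex.Re B by rewrite ler_pM2l// ge_min lexx orbT.
exists k => // x; have := blend_le x k0 kA kB; rewrite -ler_expR => le_exp.
rewrite beta_kernel_Re beta_kernel_Im !normrM !(ger0_norm (expR_ge0 _)).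
split; apply: le_trans le_exp; rewrite ler_piMr ?expR_ge0// ler_norml.
- by rewrite cos_geN1 cos_le1.
- by rewrite sin_geN1 sin_le1.
Qed.

Lemma cintegrable_beta_kernel A B : 0 < complex.Re A -> 0 < complex.Re B ->
  cintegrable leb setT (beta_kernel A B).
Proof.
move=> A0 B0; have [k k0 le_k] := beta_kernel_decay A0 B0.
split; apply: (integrable_le_expR_abs k0).
- exact: continuous_beta_kernel_Re.
- by move=> x; case: (le_k x).
- exact: continuous_beta_kernel_Im.
- by move=> x; case: (le_k x).
Qed.

(** Substituting t = u gives dt = 2 u (1 - u) dx, which raises the exponents A - 1 and B - 1 to A
    and B and leaves the factor 2. *)
Lemma cbeta_kernel A B : 0 < complex.Re A -> 0 < complex.Re B ->
  cbeta A B = 2 * cintegral leb setT (beta_kernel A B).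
Proof.
move=> A0 B0; rewrite -cintegralZ//; last exact: cintegrable_beta_kernel.
have E x : (2 * logistic x * logistic (- x))%:C *
    (cpower (logistic x) (A - 1) * cpower (1 - logistic x) (B - 1)) = 2 * beta_kernel A B x.
  rewrite -logisticN /beta_kernel -[in RHS](subrK 1 A) -[in RHS](subrK 1 B).
  rewrite (cpowerD _ (A - 1)) (cpowerD _ (B - 1)) !(cpower1 (logistic_gt0 _)) !rmorphM/=.
  by rewrite rmorph_nat; ring.
have cl' : continuous (fun x : R => 2 * logistic x * logistic (- x)).
  move=> x; apply: cvgM; first by apply: cvgM; [exact: cvg_cst|exact: continuous_logistic].
  by apply: continuous_comp; [exact: opp_continuous|exact: continuous_logistic].
have cln (u v t : R) : 0 < t < 1 -> {for t, continuous (fun t => u * ln t + v * ln (1 - t))}.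
  move=> /andP[t0 t1]; apply: cvgD; apply: cvgM; do ?exact: cvg_cst.
    exact: continuous_ln.
  apply: continuous_comp; last by apply: continuous_ln; rewrite subr_gt0.
  by apply: cvgB; [exact: cvg_cst|exact: cvg_id].
have S (G : R -> R) := integral_substitution_oo01 (@is_derive_logistic R) cl'
  (@logistic_mono R) (@logistic01 R) (@logistic_nat_cvg R) (@logistic_Nnat_cvg R) (G := G).
rewrite /cbeta /cintegral /Rintegral; congr (fine _ +i* fine _).
- rewrite S.
    by apply: eq_integral => x _; rewrite -E Re_realM mulrC.
  move=> t t01.
  rewrite (_ : (fun t => complex.Re _) = (fun t =>
      expR (complex.Re (A - 1) * ln t + complex.Re (B - 1) * ln (1 - t)) *
      cos (complex.Im (A - 1) * ln t + complex.Im (B - 1) * ln (1 - t)))); last first.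
    by apply/funext => y; exact: cpowerM_Re.
  apply: cvgM; apply: continuous_comp; do ?exact: cln.
    exact: continuous_expR.
  exact: continuous_cos.
- rewrite S.
    by apply: eq_integral => x _; rewrite -E Im_realM mulrC.
  move=> t t01.
  rewrite (_ : (fun t => complex.Im _) = (fun t =>
      expR (complex.Re (A - 1) * ln t + complex.Re (B - 1) * ln (1 - t)) *
      sin (complex.Im (A - 1) * ln t + complex.Im (B - 1) * ln (1 - t)))); last first.
    by apply/funext => y; exact: cpowerM_Im.
  apply: cvgM; apply: continuous_comp; do ?exact: cln.
    exact: continuous_expR.
  exact: continuous_sin.
Qed.

Lemma cintegral_beta_kernelSr A B : 0 < complex.Re A -> 0 < complex.Re B ->
  (A + B) * cintegral leb setT (beta_kernel A (B + 1)) =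
  B * cintegral leb setT (beta_kernel A B).
Proof.
move=> A0 B0.
have A1 : 0 < complex.Re (A + 1) by rewrite ReDc addr_gt0.
have B1 : 0 < complex.Re (B + 1) by rewrite ReDc addr_gt0.
have i0 := cintegrable_beta_kernel A0 B0.
have i1 := cintegrable_beta_kernel A0 B1.
have i2 := cintegrable_beta_kernel A1 B0.
(* Integrates u + (1 - u) = 1 against the kernel. With A J(A, B + 1) = B J(A + 1, B), obtained from
   [E2] below, this eliminates J(A + 1, B). *)
have E1 : cintegral leb setT (beta_kernel A B) =
    cintegral leb setT (beta_kernel A (B + 1)) + cintegral leb setT (beta_kernel (A + 1) B).
  rewrite -cintegralD//; apply: eq_cintegral => x _.
  by rewrite beta_kernelSr beta_kernelSl logisticN rmorphB rmorph1; ring.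
have i3 : cintegrable leb setT
    (fun x => 2 * (A * beta_kernel A (B + 1) x + (- B) * beta_kernel (A + 1) B x)).
  by apply: cintegrableZ => //; apply: cintegrableD => //; apply: cintegrableZ.
have comb (a b c d : R) (f g h l : R -> R) :
    continuous f -> continuous g -> continuous h -> continuous l ->
    continuous (fun x => 2 * (a * f x + b * g x - (c * h x + d * l x))).
  move=> cf cg ch cl x; apply: cvgM; first exact: cvg_cst.
  apply: cvgB; apply: cvgD; apply: cvgM; (try exact: cvg_cst);
    [exact: cf|exact: cg|exact: ch|exact: cl].
(* The integrand is the derivative of [beta_kernel A B]. The difference is written as a sum with - B
   so that [cintegralD] and [cintegralZ] apply. *)
have E2 : cintegral leb setT
    (fun x => 2 * (A * beta_kernel A (B + 1) x + (- B) * beta_kernel (A + 1) B x)) = 0.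
  have [k1 k10 d1] := beta_kernel_decay A0 B0.
  have [ReNy ReNNy] := expR_abs_decay k10 (fun x => (d1 x).1).
  have [ImNy ImNNy] := expR_abs_decay k10 (fun x => (d1 x).2).
  apply: complex_ext; rewrite /cintegral/=.
  - under eq_Rintegral do rewrite mulNr.
    apply: integral_derive_eq0 ReNy ReNNy.
    + exact: is_derive_beta_kernel_Re.
    + rewrite (_ : (fun x => _) = (fun x => 2 * (complex.Re A * complex.Re (beta_kernel A (B + 1) x)
        + - complex.Im A * complex.Im (beta_kernel A (B + 1) x)
        - (complex.Re B * complex.Re (beta_kernel (A + 1) B x)
        + - complex.Im B * complex.Im (beta_kernel (A + 1) B x))))); last first.
        by apply/funext => x; rewrite Re_dblBM !mulNr.
      by apply: comb; [exact: continuous_beta_kernel_Re|exact: continuous_beta_kernel_Im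
                      |exact: continuous_beta_kernel_Re|exact: continuous_beta_kernel_Im].
    + case: i3 => + _; congr (integrable _ _ _); apply/funext => x.
      by rewrite mulNr.
  - under eq_Rintegral do rewrite mulNr.
    apply: integral_derive_eq0 ImNy ImNNy.
    + exact: is_derive_beta_kernel_Im.
    + rewrite (_ : (fun x => _) = (fun x => 2 * (complex.Re A * complex.Im (beta_kernel A (B + 1) x)
        + complex.Im A * complex.Re (beta_kernel A (B + 1) x)
        - (complex.Re B * complex.Im (beta_kernel (A + 1) B x)
        + complex.Im B * complex.Re (beta_kernel (A + 1) B x))))); last first.
        by apply/funext => x; rewrite Im_dblBM.
      by apply: comb; [exact: continuous_beta_kernel_Im|exact: continuous_beta_kernel_Re
                      |exact: continuous_beta_kernel_Im|exact: continuous_beta_kernel_Re].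
    + case: i3 => _; congr (integrable _ _ _); apply/funext => x.
      by rewrite mulNr.
move: E2; rewrite cintegralZ//; last by apply: cintegrableD => //; apply: cintegrableZ.
rewrite cintegralD//; [|exact: cintegrableZ|exact: cintegrableZ].
rewrite !cintegralZ// => /eqP; rewrite mulf_eq0 pnatr_eq0/= mulNr subr_eq0 => /eqP E2.
rewrite E1; ring: E2.
Qed.

(** Origin of the third upper and the second lower parameter of the 3F2, as B and A + B. *)
Lemma cintegral_beta_kernel_pochhammer A B k : 0 < complex.Re A -> 0 < complex.Re B ->
  pochhammer (A + B) k * cintegral leb setT (beta_kernel A (B + k%:R)) =
  pochhammer B k * cintegral leb setT (beta_kernel A B).
Proof.
move=> A0 B0; elim: k => [|k IH]; first by rewrite !pochhammer0 addr0.
have Bk0 : 0 < complex.Re (B + k%:R).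
  by rewrite -(rmorph_nat (real_complex R)) ReDc/= ltr_wpDr.
rewrite !pochhammerS -natr1 addrA -mulrA -(addrA A) cintegral_beta_kernelSr// mulrCA IH.
ring.
Qed.

End beta_integral.
(** * The one-dimensional transform *)

Section hypergeometric.
Context {R : realType}.
Implicit Types (a b c d z : R[i]).

(** The partial sums are constant from index [n.+1] on, so the limit is that of an eventually
    constant sequence. *)
Lemma hyp3F2_terminating n c2 c3 d1 d2 z :
  hyp3F2 (- n%:R) c2 c3 d1 d2 z = \sum_(k < n.+1)
    (pochhammer (- n%:R) k * pochhammer c2 k * pochhammer c3 k)
    / (pochhammer d1 k * pochhammer d2 k) * (z ^+ k / k`!%:R).
Proof.
rewrite /hyp3F2; apply: (@lim_near_cst (R[i] : numFieldType)); first exact: norm_hausdorff.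
near=> m.
have nm : (n.+1 <= m)%N by near: m; exact: nbhs_infty_ge.
rewrite -!(big_mkord xpredT (fun k => pochhammer (- n%:R) k * pochhammer c2 k * pochhammer c3 k
    / (pochhammer d1 k * pochhammer d2 k) * (z ^+ k / k`!%:R))).
rewrite (big_cat_nat (n := n.+1))//= [X in _ + X]big1_seq ?addr0// => k.
rewrite mem_index_iota => /andP[_ /andP[nk _]].
by rewrite pochhammerN_eq0// !mul0r.
Unshelve. all: by end_near.
Qed.

Lemma hyp3F2_continuous_hahn n x a b c d :
  pochhammer (a + c) n != 0 -> pochhammer (a + d) n != 0 ->
  hyp3F2 (- n%:R) (n%:R + a + b + c + d - 1) (a + 'i%C * x) (a + c) (a + d) 1 =
  n`!%:R / ('i%C ^+ n * pochhammer (a + d) n * pochhammer (a + c) n)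
  * continuous_hahn n x a b c d.
Proof.
move=> ac ad; rewrite /continuous_hahn; move: (hyp3F2 _ _ _ _ _ _) => H.
have i0 : 'i%C ^+ n != 0 :> R[i] by rewrite expf_neq0// neq0Ci.
have n0 : n`!%:R != 0 :> R[i] by rewrite pnatr_eq0 -lt0n fact_gt0.
by field; rewrite i0 n0 ac ad.
Qed.

End hypergeometric.

Section coordinate.
Context {R : realType}.
Local Notation leb := (@lebesgue_measure R).

(* The factor of [g_fun] depending on the j-th variable; [N] stands for |n^{j+1}|, whose power
   is what the prefactors (1 - |x_{j-1}|)^{n_j} of the other coordinates contribute. *)
Definition coord_fun (a b : R) (N m : nat) (A beta x : R) : R :=
  (1 + tanh x) `^ a * (1 - tanh x) `^ b *
  (logistic (- x) ^+ N * jacobi m A beta (2 * logistic x - 1)).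

Lemma tanh1D (x : R) : 1 + tanh x = 2 * logistic x.
Proof. by rewrite /logistic; field. Qed.

Lemma tanh1B (x : R) : 1 - tanh x = 2 * logistic (- x).
Proof. by rewrite logisticN /logistic; field. Qed.

Lemma powR_dbl_logistic (a x : R) : (2 * logistic x) `^ a = 2 `^ a * logistic x `^ a.
Proof. by rewrite powRM// ltW// logistic_gt0. Qed.

Lemma half_imaginary (xi : R) : 'i%C * xi%:C / 2 = (0 +i* (xi / 2)) :> R[i].
Proof. by rewrite natcE -fmorphV; apply: complex_ext => /=; ring. Qed.

(** Since ln u - ln (1 - u) = 2 x, the frequency is halved in the exponents. *)
Lemma beta_kernel_exp (xi x : R) :
  beta_kernel (- ('i%C * xi%:C / 2)) ('i%C * xi%:C / 2) x = cexp (- ('i%C * (xi * x)%:C)).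
Proof.
rewrite /beta_kernel /cpower -cexpD -/(lnlogistic x) -/(lnlogistic (- x)) (lnlogisticB x).
congr cexp; rewrite rmorphD !rmorphM/= rmorph_nat; by field.
Qed.

Lemma beta_kernel_real (a b x : R) : beta_kernel a%:C b%:C x =
  (logistic x `^ a * logistic (- x) `^ b)%:C.
Proof. by rewrite /beta_kernel !cpower_real ?logistic_gt0// rmorphM. Qed.

Lemma beta_kernel0_nat (k : nat) (x : R) :
  beta_kernel 0 k%:R x = (logistic (- x) ^+ k)%:C.
Proof.
by rewrite /beta_kernel (cpower_nat 0) ?logistic_gt0// expr0 mul1r cpower_nat ?logistic_gt0.
Qed.

Section fixed_parameters.
Variables (a b : R) (N m : nat) (A beta : R).
Hypotheses (a_gt0 : 0 < a) (b_gt0 : 0 < b) (A_gtN1 : -1 < A).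

(** The coefficient of (1 - u)^k in [jacobi_Gauss], times the 2^(a + b) released by 1 + tanh x = 2 u
    and 1 - tanh x = 2 (1 - u). *)
Let coef (k : nat) : R := 2 `^ (a + b) * (pochhammer (A + 1) m / m`!%:R *
  (pochhammer (- m%:R) k * pochhammer (m%:R + A + beta + 1) k
     / (pochhammer (A + 1) k * k`!%:R))).

Let s (xi : R) : R[i] := 'i%C * xi%:C / 2.
Let u xi : R[i] := a%:C - s xi.
Let v xi : R[i] := (N%:R + b)%:C + s xi.

Lemma coord_fun_kernel xi x :
  cexp (- ('i%C * (xi * x)%:C)) * (coord_fun a b N m A beta x)%:C =
  \sum_(k < m.+1) (coef k)%:C * beta_kernel (u xi) (v xi + k%:R) x.
Proof.
rewrite /coord_fun tanh1D tanh1B !powR_dbl_logistic.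
have -> : 2 * logistic x - 1 = 1 - 2 * logistic (- x) by rewrite logisticN; ring.
rewrite jacobi_Gauss// -beta_kernel_exp -/(s xi).
have E k : beta_kernel (u xi) (v xi + k%:R) x = beta_kernel (- s xi) (s xi) x *
    ((logistic x `^ a * logistic (- x) `^ b) * logistic (- x) ^+ N * logistic (- x) ^+ k)%:C.
  (* The exponents are split in parallel into character, weight, simplex prefactor and Jacobi power;
     the zeros pad the first one so that [beta_kernelD] separates the four factors. *)
  have -> : u xi = - s xi + a%:C + 0 + 0 by rewrite /u; ring.
  have -> : v xi + k%:R = s xi + b%:C + N%:R + k%:R by rewrite /v rmorphD rmorph_nat; ring.
  by rewrite !beta_kernelD beta_kernel_real !beta_kernel0_nat !rmorphM/= !mulrA.
transitivity (\sum_(k < m.+1) beta_kernel (- s xi) (s xi) x * (coef k *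
    (logistic x `^ a * logistic (- x) `^ b * logistic (- x) ^+ N * logistic (- x) ^+ k))%:C);
  last by apply: eq_bigr => k _; rewrite [beta_kernel (u _) _ _](E k) rmorphM mulrCA.
rewrite -mulr_sumr -rmorph_sum; congr (_ * _%:C).
rewrite !mulr_sumr; apply: eq_bigr => k _; rewrite /coef powRD; last by rewrite pnatr_eq0 implybT.
move: (pochhammer (- m%:R) k) (pochhammer (A + 1) k) (pochhammer (A + 1) m) => p1 p2 p3.
move: (pochhammer _ k) (logistic x `^ a) (logistic (- x) `^ b) (2 `^ a) (2 `^ b) => p4 l1 l2 l3 l4.
move: (logistic (- x) ^+ N) (logistic (- x) ^+ k) => l5 l6.
by rewrite !invfM; ring.
Qed.

Let Reu xi : 0 < complex.Re (u xi).
Proof.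
by rewrite /u /s half_imaginary ReDc ReNc/= subr0.
Qed.

Let Rev xi k : 0 < complex.Re (v xi + k%:R).
Proof. by rewrite /v /s half_imaginary natcE !ReDc/= addr0 ltr_wpDr// ltr_wpDl. Qed.

Lemma cintegrable_coord_fun xi : cintegrable leb setT
  (fun x => cexp (- ('i%C * (xi * x)%:C)) * (coord_fun a b N m A beta x)%:C).
Proof.
under eq_fun do rewrite coord_fun_kernel.
apply: (@cintegrable_sum _ _ _ leb setT measurableT m.+1
  (fun k x => (coef k)%:C * beta_kernel (u xi) (v xi + k%:R) x)) => // k _.
apply: cintegrableZ => //.
exact: cintegrable_beta_kernel.
Qed.

Lemma cintegral_coord_fun xi : cintegral leb setT
    (fun x => cexp (- ('i%C * (xi * x)%:C)) * (coord_fun a b N m A beta x)%:C) =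
  (2 `^ (a + b - 1) * (pochhammer (A + 1) m / m`!%:R))%:C *
  (cbeta (u xi) (v xi) *
   hyp3F2 (- m%:R) (m%:R + A + beta + 1)%:C (v xi) (A + 1)%:C (N%:R + (a + b))%:C 1).
Proof.
under eq_fun do rewrite coord_fun_kernel.
rewrite (@cintegral_sum _ _ _ leb setT measurableT m.+1
  (fun k x => (coef k)%:C * beta_kernel (u xi) (v xi + k%:R) x))//; last first.
  by move=> k _; apply: cintegrableZ => //; exact: cintegrable_beta_kernel.
have Rev0 : 0 < complex.Re (v xi) by have := Rev xi 0; rewrite addr0.
rewrite hyp3F2_terminating cbeta_kernel// !mulr_sumr; apply: eq_bigr => k _.
rewrite cintegralZ//; last exact: cintegrable_beta_kernel.
(* The frequency cancels, leaving a positive real whose Pochhammer symbols can be divided by. *)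
have D : u xi + v xi = (N%:R + (a + b))%:C.
  by rewrite /u /v !rmorphD; ring.
have p0 : pochhammer (N%:R + (a + b)) k != 0.
  by rewrite gt_eqF// pochhammer_gt0// ltr_wpDl// addr_gt0.
have P0 : pochhammer (N%:R + (a + b))%:C k != 0 :> R[i].
  by rewrite -rmorph_pochhammer fmorph_eq0.
have Q0 : pochhammer (A + 1) k != 0 by rewrite gt_eqF// pochhammer_gt0// -ltrBlDr sub0r.
have := cintegral_beta_kernel_pochhammer k (Reu xi) Rev0.
rewrite D => /(congr1 (fun z => z / pochhammer (N%:R + (a + b))%:C k)).
rewrite mulrAC mulfV// mul1r => ->.
have -> : pochhammer (- m%:R : R[i]) k = (pochhammer (- m%:R) k)%:C.
  by rewrite rmorph_pochhammer rmorphN rmorph_nat.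
(* One factor 2 is set aside for the 2 of [cbeta_kernel]. *)
have T : 2 `^ (a + b) = 2 * 2 `^ (a + b - 1).
  by rewrite -{1}(subrK 1 (a + b)) (@powRD _ 2 (a + b - 1) 1) ?pnatr_eq0 ?implybT// powRr1// mulrC.
rewrite expr1n -!rmorph_pochhammer /coef T.
have k0 : k`!%:R != 0 :> R by rewrite pnatr_eq0 -lt0n fact_gt0.
have m0 : m`!%:R != 0 :> R by rewrite pnatr_eq0 -lt0n fact_gt0.
rewrite !natcE -(rmorph1 (real_complex R)).
move: (pochhammer (N%:R + (a + b)) k) p0 (pochhammer (A + 1) k) Q0 => p p_neq0 q q_neq0.
move: (pochhammer (- m%:R : R) k) (pochhammer (m%:R + A + beta + 1) k)
  (pochhammer (A + 1) m) (2 `^ _) => p1 p2 p3 p4.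
move: k`!%:R k0 m`!%:R m0 (pochhammer (v xi) k) (cintegral _ _ _) => K K0 M M0 V J.
rewrite !(rmorphM, fmorphV)/=; field.
by rewrite !fmorph_eq0 K0 M0 p_neq0 q_neq0.
Qed.

End fixed_parameters.
End coordinate.
(** * Factorization on the simplex *)

Section simplex_coordinates.

(** The index i lies in the tails starting at 1, ..., i; hence the terms j a_j in the exponent of
    2. *)
Lemma sum_nat_triangle (V : nmodType) (F : nat -> V) m :
  \sum_(1 <= j < m.+1) \sum_(j <= i < m.+1) F i = \sum_(1 <= i < m.+1) F i *+ i.
Proof.
elim: m => [|m IH]; first by rewrite !big_nil.
rewrite big_nat_recr//= big_nat1 [RHS]big_nat_recr//= -IH mulrSr addrA; congr (_ + _).
transitivity (\sum_(1 <= j < m.+1) (\sum_(j <= i < m.+1) F i + F m.+1)).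
  by apply: eq_big_nat => j /andP[_ jm]; rewrite big_nat_recr// ltnW.
by rewrite big_split/= sumr_const_nat subSS subn0.
Qed.

(** The factor t_i occurs in the j-th prefix product exactly when j > i, so it collects the
    exponents e_j of all later j: this is where |n^{i+1}| arises. *)
Lemma prod_nat_triangle (K : comPzSemiRingType) (t : nat -> K) (e : nat -> nat) m :
  \prod_(1 <= j < m.+1) (\prod_(1 <= i < j) t i) ^+ e j =
  \prod_(1 <= i < m.+1) t i ^+ \sum_(i.+1 <= j < m.+1) e j.
Proof.
elim: m => [|m IH]; first by rewrite !big_nil.
rewrite big_nat_recr//= [RHS]big_nat_recr//= [\sum_(m.+2 <= j < m.+2) e j]big_geq// expr0 mulr1.
rewrite IH -prodrXl -big_split/=; apply: eq_big_nat => i /andP[_ im].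
by rewrite -exprD [in RHS]big_nat_recr.
Qed.

Lemma powR_sum (R : realType) (F : nat -> R) m n :
  \prod_(m <= j < n) 2 `^ F j = 2 `^ (\sum_(m <= j < n) F j) :> R.
Proof.
elim/big_rec2: _ => [|j x y _ ->]; first by rewrite powRr0.
by rewrite powRD// pnatr_eq0 implybT.
Qed.

Lemma tail_sumS (V : nmodType) (s : seq V) j : (j <= size s)%N ->
  tail_sum s j = ith s j + tail_sum s j.+1.
Proof. by move=> js; rewrite /tail_sum big_ltn. Qed.

Context {R : realType} (r : nat).
Implicit Types (n : r.-tuple nat) (a alpha : r.+1.-tuple R) (x : r.-tuple R).

(** Applied with c = 0 to [a] and with c = -1 to [alpha]; the tail has r + 2 - j terms. *)
Lemma tail_sum_gt (s : r.+1.-tuple R) c j :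
  (forall i, (1 <= i <= r.+1)%N -> c < ith s i) -> (1 <= j <= r.+1)%N ->
  c *+ (r.+2 - j) < tail_sum s j.
Proof.
move=> cs /andP[j1 jr]; rewrite -sumr_const_nat /tail_sum size_tuple.
apply: ltr_sum_nat => // i /andP[ji ir]; apply: cs.
by rewrite (leq_trans j1 ji).
Qed.

Lemma UpsilonE x k : (1 <= k)%N -> Upsilon x k =
  (\prod_(1 <= i < k) logistic (- ith x i)) * logistic (ith x k).
Proof.
case: k => // k _; rewrite /Upsilon tanh1D.
under eq_big_nat do rewrite tanh1B.
rewrite big_split/= prodr_const_nat subSS subn0 exprS; field.
by rewrite expf_neq0.
Qed.

Lemma ith_Upsilon_tuple x k : (1 <= k <= r)%N -> ith (Upsilon_tuple x) k = Upsilon x k.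
Proof.
case: k => // k /= kr.
by have := tnth_mktuple (fun k : 'I_r => Upsilon x k.+1) (Ordinal kr); rewrite (tnth_nth 0).
Qed.

Lemma head_sum_Upsilon x m : (m <= r)%N ->
  1 - head_sum (Upsilon_tuple x) m = \prod_(1 <= i < m.+1) logistic (- ith x i).
Proof.
elim: m => [|m IH] mr; first by rewrite /head_sum !big_nil subr0.
rewrite big_nat_recr//= -IH; last exact: ltnW.
rewrite /head_sum [in LHS]big_nat_recr//= opprD addrA.
rewrite ith_Upsilon_tuple ?mr// UpsilonE// -IH ?(ltnW mr)// logisticN /head_sum.
ring.
Qed.

(** The Jacobi argument separates because Upsilon_j / (1 - |Upsilon_{j-1}|) = u_j, and the
    prefactors are regrouped by [prod_nat_triangle]. *)
Lemma g_fun_prod n a alpha x : g_fun n a alpha x =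
  \prod_(1 <= j < r.+1) coord_fun (ith a j) (tail_sum a j.+1) (tail_sum n j.+1) (ith n j)
    (simplex_A n alpha j) (ith alpha j) (ith x j).
Proof.
rewrite /g_fun /coord_fun [RHS]big_split/=; congr (_ * _).
pose t j := logistic (- ith x j).
transitivity (\prod_(1 <= j < r.+1) ((\prod_(1 <= i < j) t i) ^+ ith n j *
    jacobi (ith n j) (simplex_A n alpha j) (ith alpha j) (2 * logistic (ith x j) - 1))).
  apply: eq_big_nat => j /andP[j1 jr].
  have hE : 1 - head_sum (Upsilon_tuple x) j.-1 = \prod_(1 <= i < j) t i.
    by rewrite head_sum_Upsilon ?prednK//; lia.
  have p0 : \prod_(1 <= i < j) t i != 0.
    by rewrite gt_eqF// prodr_gt0// => i _; exact: logistic_gt0.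
  rewrite hE; congr (_ * jacobi _ _ _ (_ - 1)).
  rewrite ith_Upsilon_tuple ?j1// UpsilonE// -/t.
  by field.
rewrite !big_split/= prod_nat_triangle; congr (_ * _).
by apply: eq_big_nat => j _; rewrite /tail_sum size_tuple.
Qed.

Lemma sum_tail_sumB1 a : (1 <= r)%N ->
  \sum_(1 <= j < r.+1) (tail_sum a j - 1) =
  r%:R * (ith a r + ith a r.+1 - 1) + \sum_(1 <= j < r) j%:R * ith a j.
Proof.
move=> r0; rewrite sumrB sumr_const_nat subSS subn0.
(* The last entry of [a] lies in all r tails, so it is peeled off before the triangular count. *)
transitivity (\sum_(1 <= j < r.+1) (\sum_(j <= i < r.+1) ith a i + ith a r.+1) - r%:R).
  congr (_ - _); apply: eq_big_nat => j /andP[j1 jr].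
  by rewrite /tail_sum size_tuple big_nat_recr//= ltnW.
rewrite big_split/= sum_nat_triangle sumr_const_nat subSS subn0 big_nat_recr//=.
under eq_bigr do rewrite -mulr_natl.
rewrite -(mulr_natl (ith a r)) -(mulr_natl (ith a r.+1)).
move: (\sum_(1 <= _ < r) _) (ith a r) (ith a r.+1) (r%:R : R) => z1 z2 z3 z4.
by ring.
Qed.

End simplex_coordinates.
(** Integrability is part of the conclusion because the real integral is defined through [fine],
    which returns a value even when the integral is infinite or undefined; it certifies that the
    transform is a genuine Lebesgue integral. *)
Theorem theorem3p2 (R : realType) (r : nat) (hr : (1 <= r)%N)
    (n : r.-tuple nat) (a alpha : r.+1.-tuple R)
    (ha : forall j, (1 <= j <= r.+1)%N -> 0 < ith a j)
    (halpha : forall j, (1 <= j <= r.+1)%N -> -1 < ith alpha j)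
    (xi : r.-tuple R) :
  [/\ (lebesgue_tuple r).-integrable setT (fun x => (g_fun n a alpha x)%:E),
      fourier (fun x => (g_fun n a alpha x)%:C) xi =
        (2 `^ (r%:R * (ith a r + ith a r.+1 - 1)
               + \sum_(1 <= j < r) j%:R * ith a j))%:C
        * \prod_(1 <= j < r.+1)
            ((pochhammer (2 * (tail_sum n j.+1)%:R + tail_sum alpha j.+1
                          + r%:R - j%:R + 1) (ith n j)
              / (ith n j)`!%:R)%:C
             * Lambda a alpha n j (ith xi j))
    & forall j, (1 <= j <= r)%N ->
      let nj := ith n j in
      let N : R := (tail_sum n j.+1)%:R in
      let s : R[i] := 'i%C * (ith xi j)%:C / 2 in
      Lambda a alpha n j (ith xi j) =
        nj`!%:R * cbeta ((ith a j)%:C - s) ((N + tail_sum a j.+1)%:C + s)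
        / ('i%C ^+ nj
           * (pochhammer (N + tail_sum a j) nj)%:C
           * (pochhammer (2 * N + tail_sum alpha j.+1 + r%:R - j%:R + 1) nj)%:C)
        * continuous_hahn nj (ith xi j / 2)%:C
            (N + tail_sum a j.+1)%:C
            (ith alpha j - ith a j + 1)%:C
            (N + tail_sum alpha j.+1 - tail_sum a j.+1 + r%:R - j%:R + 1)%:C
            (ith a j)%:C].
Proof.
have ta0 j : (1 <= j <= r)%N -> 0 < tail_sum a j.+1.
  by move=> /andP[j1 jr]; have := tail_sum_gt ha (j := j.+1); rewrite mul0rn; apply.
have A1 j : (1 <= j <= r)%N -> -1 < simplex_A n alpha j.
  (* The r + 1 - j entries of the tail, each above -1, sum to more than - (r + 1 - j), and adding r
     - j leaves more than -1. *)
  move=> /andP[j1 jr]; have := tail_sum_gt halpha (j := j.+1) jr.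
  rewrite mulNrn subSS natrB; last exact: leqW.
  rewrite /simplex_A; have : 0 <= (tail_sum n j.+1)%:R :> R by [].
  rewrite -natr1; lra.
(* Here [i] counts from 0, as the tuple lemma does, hence the shifts to [i.+1] and [i.+2]. *)
pose F (xi : r.-tuple R) (i : nat) (y : R) : R[i] :=
  cexp (- ('i%C * (ith xi i.+1 * y)%:C)) * (coord_fun (ith a i.+1) (tail_sum a i.+2)
    (tail_sum n i.+2) (ith n i.+1) (simplex_A n alpha i.+1) (ith alpha i.+1) y)%:C.
have iF xi' i : (i < r)%N -> cintegrable lebesgue_measure setT (F xi' i).
  move=> ir; apply: cintegrable_coord_fun; [apply: ha; lia|apply: ta0|apply: A1].
    by lia.
  by lia.
have FE xi' (x : r.-tuple R) : \prod_(i < r) F xi' i x`_i =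
    cexp (- ('i%C * (\sum_(1 <= j < r.+1) ith xi' j * ith x j)%:C)) * (g_fun n a alpha x)%:C.
  rewrite big_split/= g_fun_prod rmorph_prod/= -cexp_sum; congr (cexp _ * _).
    by rewrite sumrN -mulr_sumr -rmorph_sum big_add1 big_mkord.
  by rewrite big_add1 big_mkord.
split.
(* At frequency 0 the character is 1 and the product is [g_fun] itself. *)
- have [[+ _] _] := cintegral_lebesgue_tuple (iF [tuple 0 | i < r]).
  apply: eq_integrable => // x _; rewrite FE; congr _%:E.
  rewrite [X in cexp X](_ : _ = 0) ?cexp0 ?mul1r//.
  rewrite big1_seq ?rmorph0 ?mulr0 ?oppr0// => j; rewrite mem_index_iota => /andP[_ /andP[j1 jr]].
  have jr' : (j.-1 < r)%N by lia.
  have := tnth_mktuple (fun=> 0 : R) (Ordinal jr').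
  by rewrite (tnth_nth 0) /ith => ->; rewrite mul0r.
- have [_] := cintegral_lebesgue_tuple (iF xi).
  rewrite /fourier; under [X in cintegral _ _ X = _ -> _]eq_fun do rewrite FE.
  move=> ->.
  (* The global power of 2 is redistributed as a product of 2^(|a^j| - 1), so that the identity can
     be checked one coordinate at a time. *)
  rewrite -(sum_tail_sumB1 a hr) -powR_sum rmorph_prod/= -big_split/= [RHS]big_add1 big_mkord.
  apply: eq_bigr => i _.
  have ir := ltn_ord i.
  rewrite /F cintegral_coord_fun; [|apply: ha; lia|apply: ta0; lia|apply: A1; lia].
  rewrite /Lambda /simplex_A (@tail_sumS _ a i.+1) ?size_tuple; last lia.
  rewrite (@tail_sumS _ alpha i.+1) ?size_tuple; last lia.
  have -> : (ith n i.+1)%:R +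
        (2 * (tail_sum n i.+2)%:R + tail_sum alpha i.+2 + r%:R - i.+1%:R) + ith alpha i.+1 + 1 =
      (ith n i.+1)%:R + 2 * (tail_sum n i.+2)%:R +
        (ith alpha i.+1 + tail_sum alpha i.+2) + r%:R - i.+1%:R + 1 :> R by ring.
  exact: real_complexMA.
- move=> j /andP[j1 jr] nj N s.
  have jr' : (1 <= j <= r)%N by rewrite j1.
  have N0 : 0 <= N by rewrite /N.
  have taj : tail_sum a j = ith a j + tail_sum a j.+1.
    by rewrite (@tail_sumS _ a j) ?size_tuple//; lia.
  have taj0 : 0 < N + tail_sum a j.
    rewrite taj ltr_wpDl// addr_gt0 ?ta0//; apply: ha; lia.
  have talj : tail_sum alpha j = ith alpha j + tail_sum alpha j.+1.
    by rewrite (@tail_sumS _ alpha j) ?size_tuple//; lia.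
  have d0 : 0 < 2 * N + tail_sum alpha j.+1 + r%:R - j%:R + 1.
    by have := A1 j jr'; rewrite /simplex_A -/N; lra.
  (* With p, q, c, d the four Hahn parameters in order, [E1] and [E2] identify p + c and p + d with
     the lower parameters of the 3F2, [E3] and [E4] the two remaining upper ones. *)
  have E1 : (N + tail_sum a j.+1)%:C +
      (N + tail_sum alpha j.+1 - tail_sum a j.+1 + r%:R - j%:R + 1)%:C =
      (2 * N + tail_sum alpha j.+1 + r%:R - j%:R + 1)%:C :> R[i].
    by rewrite -rmorphD; congr _%:C; ring.
  have E2 : (N + tail_sum a j.+1)%:C + (ith a j)%:C = (N + tail_sum a j)%:C :> R[i].
    by rewrite -rmorphD taj; congr _%:C; ring.
  have E3 : (N + tail_sum a j.+1)%:C + 'i%C * (ith xi j / 2)%:C = (N + tail_sum a j.+1)%:C + s.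
    by rewrite /s rmorphM fmorphV rmorph_nat mulrA.
  have E4 : nj%:R + (N + tail_sum a j.+1)%:C + (ith alpha j - ith a j + 1)%:C +
      (N + tail_sum alpha j.+1 - tail_sum a j.+1 + r%:R - j%:R + 1)%:C + (ith a j)%:C - 1 =
      (nj%:R + 2 * N + tail_sum alpha j + r%:R - j%:R + 1)%:C :> R[i].
    rewrite -(rmorph_nat (real_complex R) nj) -(rmorph1 (real_complex R)) -!rmorphD -rmorphB.
    by rewrite talj; congr _%:C; ring.
  have := @hyp3F2_continuous_hahn R nj (ith xi j / 2)%:C (N + tail_sum a j.+1)%:C
    (ith alpha j - ith a j + 1)%:C
    (N + tail_sum alpha j.+1 - tail_sum a j.+1 + r%:R - j%:R + 1)%:C (ith a j)%:C.
  rewrite E1 E2 E3 E4 -!rmorph_pochhammer !fmorph_eq0 !gt_eqF ?pochhammer_gt0// => /(_ isT isT).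
  rewrite /Lambda -/nj -/N -/s => ->.
  by rewrite mulrA [cbeta _ _ * (_ / _)]mulrA [cbeta _ _ * _`!%:R]mulrC.
Qed.
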